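(* Let $u(t)$ be the exact solution of the initial value problem $u_t=f(t,u)=\sum_{\nu=1}^{\Lambda}f_\nu(t,u)$, $u(0)=u_0$, and consider one time interval $t\in[0,h]$ of an integral deferred correction (IDC) method. Suppose Lie–Trotter splitting is used in the prediction step and in the $c_s$ successive correction steps, and that the sub-problems in each step are solved exactly. If $u(t)$ and the $f_\nu$ are at least $c_s+3$ times differentiable, then the splitting error after $c_s$ correction steps is of order $c_s+2$: $$\|u(h)-u^{\{c_s\}}(h)\|=\mathcal{O}(h^{c_s+2})\quad\text{as } h\to 0,$$ where $u^{\{c_s\}}$ denotes the approximation obtained after the prediction step and $c_s$ correction steps.
   Context: Here $u(t)\in\mathbb{R}^n$, $f,f_\nu:\mathbb{R}^+\times\mathbb{R}^n\to\mathbb{R}^n$, $\Lambda\ge 2$, and $c_s\ge 0$ is the number of correction steps. Exact Lie–Trotter splitting with step $\tau>0$ for a problem $w'=\sum_{\nu=1}^{\Lambda} g_\nu(t,w)$, $w(0)=w_0$: solve successively for $\nu=1,\dots,\Lambda$ the sub-problems $w_\nu'(t)=g_\nu(t,w_\nu(t))$ on $t\in[0,\tau]$, with $w_1(0)=w_0$ and $w_\nu(0)=w_{\nu-1}(\tau)$ for $\nu\ge 2$; the approximation to $w(\tau)$ is $w_\Lambda(\tau)$. Prediction step: $u^{\{0\}}(\tau)$ is the result of exact Lie–Trotter splitting with step $\tau$ applied to the initial value problem for $u$ (with $g_\nu=f_\nu$, $w_0=u_0$), for $0<\tau\le h$, and $u^{\{0\}}(0)=u_0$. $k$-th correction step ($k=1,\dots,c_s$):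 let $e^{(k-1)}(t)=u(t)-u^{\{k-1\}}(t)$, let $\epsilon^{(k-1)}(t)=(u^{\{k-1\}})'(t)-f(t,u^{\{k-1\}}(t))$ be the residual, so that $Q^{(k-1)}(t)=e^{(k-1)}(t)+\int_0^t\epsilon^{(k-1)}(\tau)\,d\tau$ solves the error equation $$(Q^{(k-1)})'(t)=\sum_{\nu=1}^{\Lambda}G_\nu^{(k-1)}(t,Q^{(k-1)}(t)),\qquad Q^{(k-1)}(0)=0,$$ $$G^{(k-1)}_\nu(t,Q)=f_\nu\Big(t,\,u^{\{k-1\}}(t)+Q-\int_0^t\epsilon^{(k-1)}(\tau)\,d\tau\Big)-f_\nu\big(t,u^{\{k-1\}}(t)\big).$$ Let $Q_\Lambda^{\{k-1\}}(\tau)$ be the result of exact Lie–Trotter splitting with step $\tau$ applied to this error equation (with $g_\nu=G_\nu^{(k-1)}$, $w_0=0$). The updated approximation is $u^{\{k\}}(\tau)=u^{\{k-1\}}(\tau)+Q_\Lambda^{\{k-1\}}(\tau)-\int_0^\tau\epsilon^{(k-1)}(s)\,ds$ for $0<\tau\le h$, and $u^{\{k\}}(0)=u_0$. All quantities are considered for sufficiently small $h$, for which the sub-problems are solvable. *)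

(* Defs.v *)
From HB Require Import structures.
From mathcomp Require Import all_boot all_order all_algebra.
From mathcomp Require Import all_classical all_reals all_analysis.

Set Implicit Arguments.
Unset Strict Implicit.
Unset Printing Implicit Defensive.

Import Order.TTheory GRing.Theory Num.Theory.
Import numFieldNormedType.Exports.
Local Open Scope classical_set_scope.
Local Open Scope ring_scope.

(* MathComp-Analysis.  Derivatives are taken relative to the set on which the
   functions are given ([0, T], [0, tau], [0, +oo[ x R^n, ...), hence are
   one-sided at its boundary; values outside of that set play no role. *)

Section Differentiability.
Context {R : realType}.

Definition frechet_within (V W : normedModType R) (D : set V) (g : V -> W)
    (x : V) (L : {linear V -> W}) : Prop :=
  continuous L /\
  forall e : R, 0 < e -> \forall y \near within D (nbhs x),
    `|g y - g x - L (y - x)| <= e * `|y - x|.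

(* "m times differentiable on D".  The derivative Dg : V -> L(V, W) is required
   to be m - 1 times differentiable through its evaluations x |-> Dg x v, which
   for finite-dimensional V is differentiability into L(V, W).  No continuity
   of the derivative of order m is required. *)
Fixpoint times_differentiable (V W : normedModType R) (m : nat) (D : set V)
    (g : V -> W) : Prop :=
  if m is m'.+1 then
    exists Dg : V -> {linear V -> W},
      (forall x, D x -> frechet_within D g x (Dg x)) /\
      (forall v, times_differentiable m' D (fun x => Dg x v))
  else True.

Definition difference_quotient (W : normedModType R) (w : R -> W) (t s : R) : W :=
  (s - t)^-1 *: (w s - w t).

Definition is_deriv_within (W : normedModType R) (D : set R) (w : R -> W)
    (t : R) (v : W) : Prop :=
  difference_quotient w t s @[s --> within D t^'] --> v.

Definition deriv_within (W : normedModType R) (D : set R) (w : R -> W)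
    (t : R) : W :=
  lim (difference_quotient w t s @[s --> within D t^']).

End Differentiability.

Section Splitting.
Context {R : realType} {n : nat}.
Local Notation vec := 'rV[R]_n.

(* w' = g(t, w) on [0, T] *)
Definition ode_solution (T : R) (g : R -> vec -> vec) (w : R -> vec) : Prop :=
  forall t, t \in `[0, T] -> is_deriv_within `[0, T] w t (g t (w t)).

(* Families of vector fields are indexed by nu = 1, ..., Lam; the members of
   index 0 or > Lam are irrelevant. *)
Definition total_field (Lam : nat) (g : nat -> R -> vec -> vec)
    (t : R) (x : vec) : vec :=
  \sum_(1 <= nu < Lam.+1) g nu t x.

(* y is the result w_Lam(tau) of exact Lie-Trotter splitting with step tau
   applied to w' = sum_nu g_nu(t, w), w(0) = w0. *)
Definition lie_trotter (Lam : nat) (g : nat -> R -> vec -> vec) (w0 : vec)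
    (tau : R) (y : vec) : Prop :=
  exists w : nat -> R -> vec,
    [/\ w 1%N 0 = w0,
        forall nu, (2 <= nu <= Lam)%N -> w nu 0 = w nu.-1 tau,
        forall nu, (1 <= nu <= Lam)%N -> ode_solution tau (g nu) (w nu)
      & y = w Lam tau].

Definition vec_integral (t : R) (g : R -> vec) : vec :=
  \row_i (\int[lebesgue_measure]_(s in `[0, t]) g s 0 i).

(* The residual is v' - f(t, v) with the derivative in its total form. *)
Definition residual (f : R -> vec -> vec) (h : R) (v : R -> vec) (t : R) : vec :=
  deriv_within `[0, h] v t - f t (v t).

Definition int_residual (f : R -> vec -> vec) (h : R) (v : R -> vec)
    (t : R) : vec :=
  vec_integral t (residual f h v).

Definition error_field (Lam : nat) (f : nat -> R -> vec -> vec) (h : R)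
    (v : R -> vec) (nu : nat) (t : R) (Q : vec) : vec :=
  f nu t (v t + Q - int_residual (total_field Lam f) h v t) - f nu t (v t).

(* U k is the k-th IDC approximation on [0, h]: k = 0 for the prediction, then
   k = 1, ..., cs.  All the sub-problems are solved exactly; in particular they
   are solvable, which is the only way in which smallness of h enters here. *)
Definition idc_approximations (Lam cs : nat) (f : nat -> R -> vec -> vec)
    (u0 : vec) (h : R) (U : nat -> R -> vec) : Prop :=
  [/\ forall k, (k <= cs)%N -> U k 0 = u0,
      forall tau, tau \in `]0, h] -> lie_trotter Lam f u0 tau (U 0%N tau)
    & forall k, (1 <= k <= cs)%N -> forall tau, tau \in `]0, h] ->
      exists2 QL : vec,
        lie_trotter Lam (error_field Lam f h (U k.-1)) 0 tau QL
      & U k tau =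
          U k.-1 tau + QL - int_residual (total_field Lam f) h (U k.-1) tau].

End Splitting.

(* Main.v *)
(* The fields are Lipschitz near (0, u0), so each sub-flow of the prediction is
   w(0) + t f_nu(0, u0) + O(t^2) and the prediction has error O(t^2).  If v is an
   approximation with error O(t^k) on [0, h], then its residual integrates to
   v - y, where y = u0 + int_0 f(s, v(s)) ds is a Picard iterate and has error
   O(t^(k+1)).  One correction turns v into y + Q, with Q the splitting result for
   the error equation; its fields are bounded by a constant times
   |Q| + |v - y| = |Q| + O(t^k), so splitting from Q = 0 over [0, t] gives
   Q = O(t^(k+1)).

   The delicate point is to integrate v', as v is only defined pointwise through
   the splitting results.  A comparison argument shows that v is Lipschitz; then
   v is the integral of a density (Radon-Nikodym), which is v' almost everywhere
   (Lebesgue), and the integral ignores the null set on which the limit defining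
   v' has a junk value. *)
Require Import Defs.
From HB Require Import structures.
From mathcomp Require Import all_boot all_order all_algebra.
From mathcomp Require Import all_classical all_reals all_analysis.
From mathcomp Require Import measurable_realfun.
From mathcomp Require Import ring lra.

Set Implicit Arguments.
Unset Strict Implicit.
Unset Printing Implicit Defensive.

Import Order.TTheory GRing.Theory Num.Theory.
Import numFieldNormedType.Exports.
Local Open Scope classical_set_scope.
Local Open Scope ring_scope.

(** * Lipschitz functions are integrals of their derivatives *)

Section negligible_change.
Context d (T : measurableType d) (R : realType) (mu : {measure set T -> \bar R}).
Local Open Scope ereal_scope.
Import HBNNSimple.

(** The integral of a nonnegative function is a supremum over simple functions below it. A simple
    function below [f], set to 0 on [N], lies below [g] and has the same integral. *)
Lemma ge0_integral_le_off_null (N : set T) (f g : T -> \bar R) :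
  measurable N -> mu N = 0 ->
  (forall x, 0 <= f x) -> (forall x, 0 <= g x) ->
  (forall x, ~ N x -> f x = g x) ->
  \int[mu]_x f x <= \int[mu]_x g x.
Proof.
move=> mN N0 f0 g0 fg; rewrite !ge0_integralTE//.
apply: ge_ereal_sup => _ /= [h hf <-].
have hN x : proj_nnsfun h (measurableC mN) x = (h \_ (~` N)) x.
  by rewrite (mrestrict _ (measurableC mN)).
apply: ereal_sup_ubound; exists (proj_nnsfun h (measurableC mN)) => [x|].
  rewrite hN patchE; case: ifPn => //; rewrite inE/= => Nx.
  by rewrite -fg.
rewrite -!integralT_nnsfun.
apply: ge0_ae_eq_integral => //.
- exact/measurable_EFinP.
- exact/measurable_EFinP.
- by move=> x _; rewrite lee_fin.
- by move=> x _; rewrite lee_fin.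
exists N; split => // x /= /not_implyP[_] h0.
apply: contrapT => Nx; apply: h0.
by have /= -> := hN x; rewrite patchE mem_set.
Qed.

(* Unlike in [ae_eq_integral], neither function is assumed measurable. *)
Lemma integral_eq_off_null (D N : set T) (f g : T -> \bar R) :
  measurable N -> mu N = 0 -> (forall x, D x -> ~ N x -> f x = g x) ->
  \int[mu]_(x in D) f x = \int[mu]_(x in D) g x.
Proof.
move=> mN N0 fg.
have fgD x : ~ N x -> (f \_ D) x = (g \_ D) x.
  move=> Nx; rewrite !patchE; case: ifPn => //; rewrite inE => Dx.
  exact: fg.
rewrite integral_mkcond [in RHS]integral_mkcond integralE [in RHS]integralE.
by congr (_ - _); apply/eqP; rewrite eq_le; apply/andP; split;
  apply: (ge0_integral_le_off_null mN N0) => // x Nx;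
  rewrite ?funeposE ?funenegE fgD.
Qed.

End negligible_change.

Section lipschitz_density.
Context {R : realType}.
Notation mu := (@lebesgue_measure R).

Lemma lipschitz_continuous (K : R) (g : R -> R) :
  (forall s t, `|g s - g t| <= K * `|s - t|) -> continuous g.
Proof.
move=> glip x; apply/cvgrPdist_le => e e0; near=> y.
have K0 : 0 < `|K| + 1 by rewrite ltr_wpDl.
apply: le_trans (glip _ _) _; apply: (@le_trans _ _ ((`|K| + 1) * `|x - y|)).
  by rewrite ler_wpM2r// ler_wpDr// ler_norm.
rewrite mulrC -ler_pdivlMr//; near: y.
by apply: cvgr_dist_le => //; exact: divr_gt0.
Unshelve. all: by end_near. Qed.

Lemma cumulative_itv (g : cumulative R R) (x y : R) : x <= y ->
  lebesgue_stieltjes_measure g `]x, y]%classic = (g y - g x)%:E.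
Proof.
move=> xy; rewrite /lebesgue_stieltjes_measure /measure_extension.
by rewrite measurable_mu_extE/= ?wlength_itv_bnd//; exact: is_ocitv.
Qed.

(** Gives access to the Stieltjes measure of [g]; the structure is packed from the hypotheses, hence
    the existential form. *)
Lemma lipschitz_cumulative (g : R -> R) (K : R) : {homo g : x y / x <= y} ->
  (forall x y, `|g x - g y| <= K * `|x - y|) ->
  exists G : cumulative R R, g = G.
Proof.
move=> nd lip; have rc : right_continuous g.
  by move=> x; apply: cvg_at_right_filter; exact: lipschitz_continuous lip x.
pose m := isCumulative.Build R _ R g nd rc.
by exists (HB.pack_for (cumulative R R) g m).
Qed.

(** Both [K x + v x] and [K x - v x] are nondecreasing, and their Stieltjes measures add up to [2 K]
    times Lebesgue measure. The first one is therefore absolutely continuous, and its Radon-Nikodym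
    density minus [K] is the density of [v]. *)
Lemma lipschitz_integrable_derivative (v : R -> R) (K a b : R) : 0 < K -> a < b ->
  (forall x y, `|v x - v y| <= K * `|x - y|) ->
  exists phi : R -> R,
  [/\ mu.-integrable `[a, b]%classic (EFin \o phi),
      forall t, a <= t <= b ->
        v t - v a = \int[mu]_(x in `[a, t]%classic) phi x &
      exists2 N : set R, measurable N /\ mu N = 0 &
        forall t, a < t < b -> ~ N t -> is_derive t 1 v (phi t)].
Proof.
move=> K0 ab vlip.
have mono (s : R) : s = 1 \/ s = -1 ->
    exists G : cumulative R R, (fun x => K * x + s * v x) = G.
  move=> s1; have vs x y : `|s * v x - s * v y| <= K * `|x - y|.
    by rewrite -mulrBr normrM (_ : `|s| = 1) ?mul1r//;
      case: s1 => ->; rewrite ?normrN normr1.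
  apply: (@lipschitz_cumulative _ (2 * K)) => [x y xy|x y].
    have := vs x y; rewrite [`|x - y|]distrC (ger0_norm (_ : 0 <= y - x)) ?subr_ge0//.
    rewrite ler_norml => /andP[_]; lra.
  have -> : K * x + s * v x - (K * y + s * v y) =
    K * (x - y) + (s * v x - s * v y) by ring.
  apply: le_trans (ler_normD _ _) _; rewrite normrM (gtr0_norm K0).
  by have := vs x y; lra.
have [G1 G1E] := mono 1 (or_introl erefl).
have [G2 G2E] := mono (-1) (or_intror erefl).
have G1e x : G1 x = K * x + v x by rewrite -G1E mul1r.
have G2e x : G2 x = K * x - v x by rewrite -G2E mulN1r.
pose nu1 := lebesgue_stieltjes_measure G1.
pose nu2 := lebesgue_stieltjes_measure G2.
have K2 : 0 <= (2 * K)^-1 by rewrite invr_ge0 mulr_ge0// ltW.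
(* On []x, y]] the contributions of [v] cancel and the normalised sum has mass [y - x]; uniqueness
   of Lebesgue measure then identifies the two. *)
pose la : {measure set (measurableTypeR R) -> \bar R} :=
  mscale (NngNum K2) (measure_add nu1 nu2).
have laA A : la A = (((2 * K)^-1)%:E * (nu1 A + nu2 A))%E.
  by rewrite -measure_addE.
have laE A : measurable A -> mu A = la A.
  apply: lebesgue_measure_unique => X /ocitvP[->|[[x y] /= xy ->]].
    by rewrite !measure0.
  rewrite laA /nu1 /nu2.
  rewrite !cumulative_itv ?ltW// /lebesgue_measure cumulative_itv ?ltW//=.
  rewrite !G1e !G2e -EFinD -EFinM; congr EFin.
  by field; rewrite gt_eqF.
have nudom : nu1 `<< mu.
  apply/null_content_dominatesP => A mA A0.
  have := laE A mA; rewrite A0 laA => /esym/eqP.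
  rewrite mule_eq0 eqe invr_eq0 mulf_eq0 pnatr_eq0/= gt_eqF//=.
  rewrite padde_eq0 ?measure_ge0// => /andP[/eqP ? _]; assumption.
have mab : measurable (`]a, b]%classic : set (measurableTypeR R)).
  exact: measurable_itv.
have nuab : (nu1 `]a, b]%classic < +oo)%E.
  by rewrite /nu1 cumulative_itv ?ltry// ltW.
(* Restriction to []a, b]] yields the finite measure to which Radon-Nikodym is applied. *)
pose nur : {finite_measure set (measurableTypeR R) -> \bar R} := mfrestr mab nuab.
have nurdom : nur `<< mu.
  apply/null_content_dominatesP => A mA A0.
  rewrite /nur/= /mfrestr /mrestr.
  have /null_content_dominatesP := nudom; apply.
    exact: measurableI.
  apply/eqP; rewrite eq_le measure_ge0 andbT -A0.
  by apply: le_measure; rewrite ?inE//; exact: measurableI.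
have [psi [psi0 psifin psiint psiE]] := radon_nikodym_sigma_finite nurdom.
have psiF : EFin \o (fine \o psi) = psi.
  by apply/funext => x /=; rewrite fineK.
have intpsi (A : set R) : measurable A -> mu.-integrable A (EFin \o (fine \o psi)).
  by move=> mA; rewrite psiF; apply: integrableS psiint.
have intcst (t : R) : mu.-integrable `[a, t]%classic (EFin \o cst K).
  by apply: continuous_compact_integrable;
    [exact: segment_compact | apply: cst_continuous].
pose phi (x : R) : R := fine (psi x) - K.
have intphi (t : R) : mu.-integrable `[a, t]%classic (EFin \o phi).
  rewrite [X in _.-integrable _ X](_ : _ =
    ((EFin \o (fine \o psi)) \- (EFin \o cst K))%E); last first.
    by apply/funext => x.
  by apply: integrableB => //; exact: intpsi.
have phiE t : a <= t <= b -> v t - v a = \int[mu]_(x in `[a, t]%classic) phi x.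
  move=> /andP[at_ tb]; rewrite RintegralB//; last 1 first.
    exact: intpsi.
  rewrite -Rintegral_itv_obnd_cbnd; last exact: intpsi.
  rewrite Rintegral_cst//= lebesgue_measure_itv/=.
  have -> : \int[mu]_(x in `]a, t]) fine (psi x) = G1 t - G1 a.
    rewrite /Rintegral.
    under eq_integral do rewrite fineK//.
    rewrite -psiE//; rewrite /nur/= /mfrestr /mrestr.
    rewrite setIidl ?cumulative_itv//.
    by move=> x/=; rewrite !in_itv/= => /andP[-> /le_trans ->].
  rewrite !G1e lte_fin; case: ifPn => [_|]; first by rewrite /=; ring.
  rewrite -leNgt => ta; have -> : t = a by apply/le_anti/andP.
  by rewrite /=; ring.
exists phi; split => //.
(* Extension of [phi] by zero gives a function integrable on the whole line, as the Lebesgue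
   differentiation form of the fundamental theorem expects; [N] below collects the points where that
   theorem gives no derivative. *)
pose D : set R := `[a, b]%classic.
have phi0int : mu.-integrable setT (EFin \o (phi \_ D)).
  have := intphi b; rewrite integrable_mkcond// restrict_EFin; exact.
have := @FTC1 R (phi \_ D) (BLeft a).
case.
- by move=> y; apply: integrableS phi0int.
- by apply: integrable_locally (intphi b); exact: measurable_itv.
move=> N [mN N0 Nsub]; exists N => // t /andP[at_ tb] Nt.
pose F x := \int[mu]_(y in `[a, x]%classic) (phi \_ D) y.
have [dF F'] : derivable F t 1 /\ derive1 F t = phi t.
  apply: contrapT => h; apply: Nt; apply: Nsub => /= G; apply: h.
  case: G; first by rewrite lte_fin.
  move=> dF ->; split=> //.
  by rewrite patchE mem_set// /D/= in_itv/= !ltW.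
have dF' : is_derive t 1 F (phi t).
  by rewrite -F' derive1E; exact: derivableP.
apply: (@near_eq_is_derive _ _ _ (fun x => v a + F x)); last first.
  by rewrite -[phi t]add0r; apply: is_deriveD.
near=> x; rewrite /F.
have xab : a <= x <= b by apply/andP; split; near: x; [exact: lt_le_nbhsr|
  exact: lt_le_nbhsl].
have -> : \int[mu]_(y in `[a, x]%classic) (phi \_ D) y =
    \int[mu]_(y in `[a, x]%classic) phi y; last by rewrite -phiE// addrC subrK.
apply: eq_Rintegral => y; rewrite inE/= in_itv/= => /andP[ay yx].
by rewrite patchE mem_set// /D/= in_itv/= ay (le_trans yx)//; case/andP: xab.
Unshelve. all: by end_near. Qed.
End lipschitz_density.

(** * Relative derivatives and the growth of solutions *)

Section derivatives_within.
Context {R : realType}.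

Lemma is_deriv_withinP (W : normedModType R) (D : set R) (w : R -> W) (t : R)
    (v : W) :
  is_deriv_within D w t v <->
  forall e : R, 0 < e -> exists2 d : R, 0 < d &
    forall s, D s -> `|s - t| < d -> `|w s - w t - (s - t) *: v| <= e * `|s - t|.
Proof.
rewrite /is_deriv_within; split=> [/cvgrPdist_le H e e0|H].
  have [d /= d0 Hd] := H _ e0; exists d => // s Ds st.
  have [->|nst] := eqVneq s t.
    by rewrite !subrr scale0r subr0 !normr0 mulr0.
  have := Hd s; rewrite /= distrC => /(_ st nst Ds).
  have st0 : s - t != 0 by rewrite subr_eq0.
  rewrite /difference_quotient -[v in `|v - _|](scalerK st0) -scalerBr.
  rewrite normrZ normfV ler_pdivrMl ?normr_gt0// mulrC.
  by rewrite distrC.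
apply/cvgrPdist_le => e e0; have [d d0 Hd] := H _ e0.
exists d => //= s /= + nst Ds; rewrite distrC => st.
have st0 : s - t != 0 by rewrite subr_eq0.
rewrite /difference_quotient -[v](scalerK st0) -scalerBr.
rewrite normrZ normfV ler_pdivrMl ?normr_gt0// mulrC [leLHS]distrC.
exact: Hd.
Qed.

Lemma is_deriv_within_sub (W : normedModType R) (D D' : set R) (w : R -> W)
    (t : R) (v : W) :
  D' `<=` D -> is_deriv_within D w t v -> is_deriv_within D' w t v.
Proof.
move=> DD /is_deriv_withinP H; apply/is_deriv_withinP => e e0.
by have [d d0 Hd] := H e e0; exists d => // s /DD; exact: Hd.
Qed.

Lemma is_deriv_withinB (W : normedModType R) (D : set R) (w w' : R -> W)
    (t : R) (v v' : W) :
  is_deriv_within D w t v -> is_deriv_within D w' t v' ->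
  is_deriv_within D (fun s => w s - w' s) t (v - v').
Proof.
move=> H H'; rewrite /is_deriv_within.
rewrite (_ : difference_quotient _ _ = difference_quotient w t \-
   difference_quotient w' t); first exact: cvgB.
apply/funext => s; rewrite /difference_quotient /= -scalerBr; congr (_ *: _).
by rewrite !opprB addrACA [RHS]addrACA; congr (_ + _); rewrite addrC.
Qed.

Lemma is_deriv_within_linear (W : normedModType R) (D : set R) (t : R) (v : W) :
  is_deriv_within D (fun s => s *: v) t v.
Proof.
apply/is_deriv_withinP => e e0; exists 1 => // s _ _.
by rewrite -scalerBl subrr normr0 mulr_ge0// ltW.
Qed.

Lemma is_deriv_within_cst (W : normedModType R) (D : set R) (t : R) (c : W) :
  is_deriv_within D (fun=> c) t 0.
Proof.
apply/is_deriv_withinP => e e0; exists 1 => // s _ _.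
by rewrite scaler0 subr0 subrr normr0 mulr_ge0// ltW.
Qed.

Lemma is_deriv_within_eq (W : normedModType R) (D : set R) (w w' : R -> W)
    (t : R) (v : W) : D t -> (forall s, D s -> w s = w' s) ->
  is_deriv_within D w t v -> is_deriv_within D w' t v.
Proof.
move=> Dt ww /is_deriv_withinP H; apply/is_deriv_withinP => e e0.
have [d d0 Hd] := H e e0; exists d => // s Ds st.
by rewrite -!ww//; exact: Hd.
Qed.

Lemma is_derive_is_deriv_within (W : normedModType R) (D : set R) (w : R -> W)
    (t : R) (v : W) : is_derive t (1 : R) w v -> is_deriv_within D w t v.
Proof.
move=> [dw <-]; apply/is_deriv_withinP => e e0.
move: dw => /cvgrPdist_le/(_ _ e0)[d /= d0 Hd].
exists d => // s _ st; have [->|nst] := eqVneq s t.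
  by rewrite !subrr scale0r subr0 !normr0 mulr0.
have st0 : s - t != 0 by rewrite subr_eq0.
have /= := Hd (s - t); rewrite sub0r normrN => /(_ st st0).
rewrite [_ *: 1]mulr1 subrK; set u := 'D_1 w t.
rewrite -[u in `|u - _|](scalerK st0) -scalerBr normrZ normfV.
by rewrite ler_pdivrMl ?normr_gt0// mulrC [leLHS]distrC.
Qed.

Lemma deriv_withinE (W : normedModType R) (h t : R) (w : R -> W) (v : W) :
  0 < t < h -> is_deriv_within `[0, h]%classic w t v ->
  deriv_within `[0, h]%classic w t = v.
Proof.
move=> /andP[t0 th] H; apply: cvg_lim => //.
(* The limit is unique only if [[0, h]] has points other than [t] arbitrarily close to [t]; one is
   taken to the right of [t]. *)
apply: Build_ProperFilter_ex => P [d /= d0 Pd].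
have ht : 0 < h - t by rewrite subr_gt0.
have m0 : 0 < Num.min (d / 2) (h - t) by rewrite lt_min ht andbT divr_gt0.
exists (t + Num.min (d / 2) (h - t)); apply: Pd => /=.
- rewrite opprD addNKr normrN gtr0_norm// gt_min ltr_pdivrMr// ltr_pMr//.
  by rewrite ltr1n.
- by rewrite -subr_eq0 addrAC subrr add0r gt_eqF.
rewrite in_itv/= addr_ge0 ?(ltW t0) ?(ltW m0)//= addrC -lerBrDr.
by rewrite ge_min lexx orbT.
Qed.

Lemma rV_coord_le n (x : 'rV[R]_n) j : `|x 0 j| <= `|x|.
Proof.
rewrite [leRHS]/Num.Def.normr/= mx_normrE.
exact: (le_bigmax _ (fun ij => `|x ij.1 ij.2|) (0, j)).
Qed.

Lemma rV_norm_le n (x : 'rV[R]_n) e : 0 <= e ->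
  (forall j, `|x 0 j| <= e) -> `|x| <= e.
Proof.
move=> e0 H; rewrite /Num.Def.normr/= mx_normrE (bigmax_le _ e0)//= => -[i j] _.
by rewrite ord1.
Qed.

Lemma is_deriv_within_row n (D : set R) (w : R -> 'rV[R]_n) t (v : 'rV[R]_n) :
  (forall j, is_deriv_within D (fun s => w s 0 j : R^o) t (v 0 j)) ->
  is_deriv_within D w t v.
Proof.
move=> H; rewrite /is_deriv_within; apply/cvgrPdist_le => e e0.
near=> s; apply: rV_norm_le; first exact: ltW.
move=> j; move: j; near: s; apply: filter_forall => j.
have /cvgrPdist_le/(_ _ e0) := H j; apply: filterS => s.
by rewrite /difference_quotient !mxE.
Unshelve. all: by end_near. Qed.

End derivatives_within.

Section growth.
Context {R : realType} {W : normedModType R}.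

(* A continuation argument: it plays the part of both Gronwall's lemma and the
   mean value inequality. *)
Lemma growth_bound (a b M : R) (z dz : R -> W) :
  (forall t, a <= t <= b -> is_deriv_within `[a, b]%classic z t (dz t)) ->
  (forall t, a <= t <= b -> `|z t - z a| <= M * (t - a) -> `|dz t| < M) ->
  forall t, a <= t <= b -> `|z t - z a| <= M * (t - a).
Proof.
move=> zd zM t0 t0ab; rewrite leNgt; apply/negP => bad.
have inab s : a <= s <= b -> `[a, b]%classic s by rewrite /= in_itv.
have ab : a <= b by case/andP: t0ab => ? /(le_trans _); exact.
have M0 : 0 < M.
  apply: le_lt_trans (zM a _ _); rewrite ?lexx//.
  by rewrite !subrr normr0 mulr0.
pose B := [set t | a <= t <= b /\ M * (t - a) < `|z t - z a|].
have hB : has_inf B.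
  by split; [exists t0 | exists a => t [] /andP[]].
(* [c] is the infimum of the times at which the bound fails; the bound holds before [c], then at
   [c], then slightly beyond [c], which is absurd. *)
pose c := inf B.
have lbB : lbound B c by exact: inf_lbound (proj2 hB).
have ac : a <= c by apply: lb_le_inf => [|t [] /andP[]//]; exact: (proj1 hB).
have cb : c <= b by apply: le_trans (lbB t0 _) _ => //; case/andP: t0ab.
have cab : a <= c <= b by rewrite ac.
have left s : a <= s -> s < c -> `|z s - z a| <= M * (s - a).
  move=> as_ sc; rewrite leNgt; apply/negP => sB.
  have := lbB s; rewrite leNgt sc => H; suff : false by [].
  by apply: H; split => //; rewrite as_ (le_trans (ltW sc)).
have goodc : `|z c - z a| <= M * (c - a).
  rewrite leNgt; apply/negP => badc.
  have [ca|ca] := eqVneq c a.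
    by move: badc; rewrite ca !subrr normr0 mulr0 ltxx.
  have {ca} ac' : a < c by rewrite lt_neqAle eq_sym ca.
  have /is_deriv_withinP /(_ 1 ltr01) [d d0 Hd] := zd c cab.
  pose k := `|dz c| + 1.
  have k0 : 0 < k by rewrite ltr_wpDl.
  pose eta := `|z c - z a| - M * (c - a).
  have eta0 : 0 < eta by rewrite subr_gt0.
  (* Near [c] the curve moves at speed at most [k], hence by at most [eta / 2] over a time [r]: an
     excess [eta] at [c] would leave an excess at [c - r]. *)
  pose r := Num.min (d / 2) (Num.min (c - a) (eta / (2 * k))).
  have r0 : 0 < r.
    by rewrite !lt_min divr_gt0//= subr_gt0 ac' divr_gt0// mulr_gt0.
  have rd : r < d.
    by rewrite gt_min; apply/orP; left; lra.
  have rca : r <= c - a by rewrite !ge_min lexx orbT.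
  have rk : k * r <= eta / 2.
    have : r <= eta / (2 * k) by rewrite !ge_min lexx !orbT.
    rewrite ler_pdivlMr ?mulr_gt0//; lra.
  have as_ : a <= c - r by lra.
  have := Hd (c - r); rewrite /= in_itv/= as_ (_ : c - r <= b); last by lra.
  rewrite (_ : c - r - c = - r); last by lra.
  rewrite normrN gtr0_norm// => /(_ isT rd) H.
  have H1 : `|z c - z (c - r)| <= k * r.
    rewrite distrC -(subrK (- r *: dz c) (z (c - r) - z c)).
    apply: le_trans (ler_normD _ _) _; rewrite normrZ normrN gtr0_norm//.
    by rewrite /k; lra.
  have H2 := left (c - r) as_ _.
  have /H2 H3 : c - r < c by lra.
  have := ler_distD (z (c - r)) (z c) (z a).
  have : M * (c - r - a) <= M * (c - a) by rewrite ler_wpM2l// ?ltW//; lra.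
  rewrite /eta in eta0 rk *; lra.
(* The strict gap [M - |dz c|] absorbs the differentiation error, so the bound survives on a right
   neighbourhood of [c], which contains a point of [B]. *)
have := zM c cab goodc; rewrite -subr_gt0 => e0.
have /is_deriv_withinP /(_ _ e0) [d d0 Hd] := zd c cab.
have [t [tab tB] tc] := inf_adherent d0 hB.
have ct : c <= t by apply: lbB.
have := Hd t (inab _ tab); rewrite ger0_norm ?subr_ge0//.
have -> : (t - c < d) = true by rewrite -/c in tc; lra.
move=> /(_ isT) H.
have : `|z t - z c| <= M * (t - c).
  rewrite -(subrK ((t - c) *: dz c) (z t - z c)).
  apply: le_trans (ler_normD _ _) _; rewrite normrZ ger0_norm ?subr_ge0//.
  by rewrite mulrBl in H; lra.
have := ler_distD (z c) (z t) (z a); lra.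
Qed.

Lemma mean_value_inequality (a b M : R) (z dz : R -> W) :
  (forall t, a <= t <= b -> is_deriv_within `[a, b]%classic z t (dz t)) ->
  (forall t, a <= t <= b -> `|dz t| <= M) ->
  forall s t, a <= s <= b -> a <= t <= b -> `|z t - z s| <= M * `|t - s|.
Proof.
move=> zd zM s t; wlog st : s t / s <= t => [hwlog sab tab|/andP[as_ _] /andP[_ tb]].
  have [st|ts] := leP s t; first exact: hwlog.
  by rewrite distrC [`|t - s|]distrC; apply: hwlog => //; exact: ltW.
rewrite ger0_norm ?subr_ge0//; apply/ler_addgt0Pr => e e0.
have k0 : 0 < 1 + (t - s) by rewrite ltr_pwDl// subr_ge0.
(* [growth_bound] asks for a strict bound on the derivative, so [M] is enlarged by an amount that
   costs at most [e] over the interval. *)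
have e'0 : 0 < e / (1 + (t - s)) by exact: divr_gt0.
apply: (@le_trans _ _ ((M + e / (1 + (t - s))) * (t - s))).
  apply: (@growth_bound s t _ z dz); rewrite ?lexx ?st//.
    move=> r /andP[sr rt]; apply: (@is_deriv_within_sub _ _ `[a, b]%classic).
      by move=> x /=; rewrite !in_itv/= => /andP[sx xt]; apply/andP; split; lra.
    by apply: zd; lra.
  move=> r /andP[sr rt] _; have : `|dz r| <= M by apply: zM; lra.
  lra.
rewrite mulrDl lerD2l mulrAC ler_pdivrMr// ler_pM2l//; lra.
Qed.

End growth.

(** * The integral of the residual *)

Section integration.
Context {R : realType}.
Notation mu := (@lebesgue_measure R).

Definition lipschitz_itv (W : normedModType R) (h K : R) (a : R -> W) :=
  forall s t, 0 <= s <= h -> 0 <= t <= h -> `|a s - a t| <= K * `|s - t|.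

(** The projection of the line onto [[0, h]]. Composition with it extends a Lipschitz function on
    [[0, h]] to the whole line with the same constant. *)
Definition clamp (h s : R) := Num.max 0 (Num.min s h).

Lemma clamp_itv h s : 0 <= h -> 0 <= clamp h s <= h.
Proof. by move=> h0; rewrite /clamp le_max lexx/= ge_max h0/= ge_min lexx orbT. Qed.

Lemma clamp_id h s : 0 <= s <= h -> clamp h s = s.
Proof. by move=> /andP[s0 sh]; rewrite /clamp min_l// max_r. Qed.

Lemma clamp_lipschitz h s t : `|clamp h s - clamp h t| <= `|s - t|.
Proof.
wlog st : s t / s <= t => [hwlog|].
  have [st|ts] := leP s t; first exact: hwlog.
  by rewrite distrC [leRHS]distrC; apply: hwlog; exact: ltW.
rewrite [leRHS]distrC [leRHS]ger0_norm ?subr_ge0// ler_norml.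
by rewrite /clamp; case: (leP s h); case: (leP t h) => ? ?;
  rewrite /Num.max; do ![case: ifP => ?]; lra.
Qed.

Lemma lipschitz_clamp_coord n (h K : R) (a : R -> 'rV[R]_n) j : 0 <= h -> 0 <= K ->
  lipschitz_itv h K a -> forall s t,
  `|a (clamp h s) 0 j - a (clamp h t) 0 j| <= K * `|s - t|.
Proof.
move=> h0 K0 alip s t; apply: (@le_trans _ _ `|a (clamp h s) - a (clamp h t)|).
  by apply: le_trans (rV_coord_le _ j); rewrite !mxE.
apply: le_trans (alip _ _ (clamp_itv _ h0) (clamp_itv _ h0)) _.
by rewrite ler_wpM2l// clamp_lipschitz.
Qed.

Lemma continuous_integrable_itv (g : R -> R) (a b : R) :
  continuous g -> mu.-integrable `[a, b]%classic (EFin \o g).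
Proof.
move=> gc; apply: continuous_compact_integrable; first exact: segment_compact.
exact: continuous_subspaceT.
Qed.

(** The base point -1 leaves room to the left of [t = 0], where a two-sided derivative is wanted
    too. *)
Lemma integral_itv_derive (g : R -> R) (t : R) : continuous g -> 0 <= t ->
  is_derive t 1 (fun s => \int[mu]_(x in `[-1, s]%classic) g x) (g t).
Proof.
move=> gc t0.
have [] := @continuous_FTC1_closed R g (-1) t (t + 1) (ltr_pwDr ltr01 (lexx t)).
- exact: continuous_integrable_itv.
- lra.
- exact: gc.
by move=> dF F'; rewrite -F' derive1E; exact: derivableP.
Qed.

Lemma vec_integral_deriv n (h K : R) (a : R -> 'rV[R]_n) t : 0 <= h -> 0 <= K ->
  lipschitz_itv h K a -> 0 <= t <= h ->
  is_deriv_within `[0, h]%classic (fun s => vec_integral s a) t (a t).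
Proof.
move=> h0 K0 alip t0h; apply: is_deriv_within_row => j.
pose g s := a (clamp h s) 0 j.
have gc : continuous g.
  exact: lipschitz_continuous (lipschitz_clamp_coord j h0 K0 alip).
pose F s := \int[mu]_(x in `[-1, s]%classic) g x.
have dF : is_deriv_within `[0, h]%classic (F : R -> R^o) t (a t 0 j).
  rewrite -[a t 0 j]/((fun s => a s 0 j) t) -(clamp_id t0h).
  apply: is_derive_is_deriv_within; rewrite {1}clamp_id//.
  by apply: integral_itv_derive => //; case/andP: t0h.
(* Subtracting the constant [F 0] moves the base point of the integral from -1 to 0. *)
have := is_deriv_withinB dF (is_deriv_within_cst `[0, h]%classic t (F 0 : R^o)).
rewrite subr0; apply: is_deriv_within_eq; first by rewrite /= in_itv.
move=> s; rewrite /= in_itv/= => /andP[s0 sh]; rewrite /F mxE.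
rewrite (@Rintegral_itvB _ g (BLeft (-1)) (BRight s) 0) ?bnd_simp//; last first.
  exact: continuous_integrable_itv.
rewrite Rintegral_itv_obnd_cbnd; last first.
  apply: integrableS (continuous_integrable_itv 0 s gc) => //.
  by apply: subset_itvr; rewrite bnd_simp.
apply: eq_Rintegral => x; rewrite inE/= in_itv/= => /andP[x0 xs].
by rewrite /g clamp_id// x0 (le_trans xs).
Qed.

End integration.

Section residual_integral.
Context {R : realType}.
Notation mu := (@lebesgue_measure R).

Lemma ae_neq (c : R) : {ae mu, forall x, x != c}.
Proof.
exists [set c]; split; [exact: measurable_set1|exact: lebesgue_measure_set1|].
by move=> x /= /negP; rewrite negbK => /eqP.
Qed.

(** Each coordinate of [v] is the integral of a density, which agrees with [deriv_within] off a null
    set and can replace it under the integral. *)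
Lemma int_residualE n (h K L : R) (F : R -> 'rV[R]_n -> 'rV[R]_n)
    (v : R -> 'rV[R]_n) (t : R) :
  0 < h -> 0 <= K -> lipschitz_itv h K v ->
  0 <= L -> lipschitz_itv h L (fun s => F s (v s)) -> 0 <= t <= h ->
  int_residual F h v t = v t - v 0 - vec_integral t (fun s => F s (v s)).
Proof.
move=> h0 K0 vlip L0 Flip t0h; have h0' := ltW h0.
have dens j : {phi : R -> R | [/\ mu.-integrable `[0, h]%classic (EFin \o phi),
    forall t, 0 <= t <= h ->
      v t 0 j - v 0 0 j = \int[mu]_(x in `[0, t]%classic) phi x &
    {ae mu, forall x, 0 < x < h ->
      is_deriv_within `[0, h]%classic (fun s => v s 0 j : R^o) x (phi x)}]}.
  apply: cid; have K1 : 0 < K + 1 by rewrite ltr_wpDl.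
  have Vlip (s s' : R) : `|v (clamp h s) 0 j - v (clamp h s') 0 j| <= (K + 1) * `|s - s'|.
    apply: le_trans (lipschitz_clamp_coord j h0' K0 vlip _ _) _.
    by rewrite ler_wpM2r// lerDl.
  have [phi [intphi phiE [N [mN N0] dphi]]] :=
    lipschitz_integrable_derivative K1 h0 Vlip.
  exists phi; split => //.
    move=> s s0h; rewrite -phiE// !clamp_id//; first by rewrite lexx.
  exists N; split => // x /= /not_implyP[x0h]; apply: contra_notP => Nx.
  apply: is_deriv_within_eq (is_derive_is_deriv_within _ (dphi _ x0h Nx)).
    by rewrite /= in_itv/=; case/andP: x0h => *; rewrite !ltW.
  by move=> s; rewrite /= in_itv/= => s0h; rewrite clamp_id.
pose phi j := sval (dens j).
have aeF : Filter (almost_everywhere mu).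
  exact: ae_filter_ringOfSetsType.
(* One null set for all coordinates; it also takes in the end points, since [deriv_withinE]
   identifies the limit at interior points. *)
have : {ae mu, forall x, x != 0 /\ x != h /\ forall j, 0 < x < h ->
    is_deriv_within `[0, h]%classic (fun s => v s 0 j : R^o) x (phi j x)}.
  apply: filterI; first exact: ae_neq.
  apply: filterI; first exact: ae_neq.
  apply: (@filter_forall _ _ (fun j x => 0 < x < h ->
    is_deriv_within `[0, h]%classic (fun s => v s 0 j : R^o) x (phi j x)) _ aeF).
  by move=> j; have [_ _] := svalP (dens j).
move=> [N [mN N0 Nsub]]; apply/rowP => j; rewrite !mxE.
have sub0t : `[0, t]%classic `<=` `[0, h]%classic.
  by apply: subset_itvl; rewrite bnd_simp; case/andP: t0h.
have [intphi phiE _] := svalP (dens j); rewrite (phiE _ t0h).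
rewrite -RintegralB//; last 2 first.
- by apply: integrableS intphi.
- pose g (s : R) : R := F (clamp h s) (v (clamp h s)) 0 j.
  have ig : mu.-integrable `[0, t]%classic (EFin \o g).
    apply: continuous_integrable_itv; apply: lipschitz_continuous.
    exact: (lipschitz_clamp_coord j h0' L0 Flip).
  apply: eq_integrable ig => // x; rewrite inE/= => /sub0t.
  by rewrite /= in_itv/= /g => x0h; rewrite clamp_id.
rewrite /Rintegral; congr fine.
apply: (integral_eq_off_null mN N0) => x x0t Nx; congr EFin.
have : x != 0 /\ x != h /\ forall j, 0 < x < h ->
    is_deriv_within `[0, h]%classic (fun s => v s 0 j : R^o) x (phi j x).
  by apply: contrapT => /Nsub.
have := sub0t _ x0t; rewrite /= in_itv/= => /andP[x0 xh].
move=> [nx0 [nxh dv]]; have x0h : 0 < x < h by rewrite !lt_neqAle eq_sym nx0 nxh x0.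
rewrite /residual (@deriv_withinE _ _ _ _ _ (\row_j phi j x) x0h) ?mxE//.
apply: is_deriv_within_row => i; rewrite mxE; exact: dv.
Qed.

End residual_integral.

(** * Local Lipschitz continuity of the fields *)

Section local_lipschitz.
Context {R : realType}.

Lemma near_withinP (V : normedModType R) (D P : set V) (x : V) :
  (\forall y \near within D (nbhs x), P y) <->
  exists2 d : R, 0 < d & forall y, D y -> `|y - x| < d -> P y.
Proof.
split=> [/nbhs_normP[d d0 Hd]|[d d0 Hd]].
  by exists d => // y Dy yx; apply: Hd => //=; rewrite distrC.
apply/nbhs_normP; exists d => // y /=; rewrite distrC => yx Dy; exact: Hd.
Qed.

Lemma frechet_within_bounded (V W : normedModType R) (D : set V) (g : V -> W)
    (x : V) (L : {linear V -> W}) : frechet_within D g x L ->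
  exists C : R, \forall y \near within D (nbhs x), `|g y| <= C.
Proof.
move=> [Lc H]; exists (`|g x| + 2).
have /near_withinP[d d0 Hd] := H 1 ltr01.
have /cvgrPdist_le/(_ 1 ltr01) := Lc 0.
move=> /nbhs_normP[d' /= d'0 Hd'].
apply/near_withinP; exists (Num.min 1 (Num.min d d')); first by rewrite !lt_min ltr01 d0.
move=> y Dy; rewrite !lt_min => /and3P[y1 yd yd'].
have := Hd y Dy yd; rewrite mul1r => H1.
have := Hd' (y - x); rewrite /ball_/= sub0r normrN linear0 sub0r normrN => /(_ yd') H2.
rewrite -(subrK (g x) (g y)) -(subrK (L (y - x)) (g y - g x)).
apply: le_trans (ler_normD _ _) _; rewrite addrC lerD2l.
by apply: le_trans (ler_normD _ _) _; lra.
Qed.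

(** Bounds on finitely many basis vectors thereby bound the whole linear map. *)
Lemma linear_prod_rV n (W : normedModType R) (L : {linear (R * 'rV[R]_n)%type -> W})
    (a : R) (y : 'rV[R]_n) :
  L (a, y) = a *: L (1, 0) + \sum_j y 0 j *: L (0, delta_mx 0 j).
Proof.
have -> : (a, y) = a *: (1, 0) + \sum_j y 0 j *: (0, delta_mx 0 j) :> (R * 'rV[R]_n)%type.
  apply/pair_equal_spec; split.
    rewrite /= raddf_sum/= big1 ?addr0 => [|j _]; first by rewrite [RHS]mulr1.
    by rewrite [LHS]mulr0.
  rewrite /= raddf_sum/= scaler0 add0r [LHS]row_sum_delta.
  by apply: eq_bigr.
rewrite linearD linearZ linear_sum; congr (_ + _).
by apply: eq_bigr => j _; rewrite linearZ.
Qed.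

Lemma frechet_within_segment (V W : normedModType R) (D : set V) (g : V -> W)
    (Dg : V -> {linear V -> W}) (p v : V) :
  (forall x, D x -> frechet_within D g x (Dg x)) ->
  (forall s, 0 <= s <= 1 -> D (p + s *: v)) ->
  forall s, 0 <= s <= 1 ->
  is_deriv_within `[0, 1]%classic (fun s => g (p + s *: v)) s (Dg (p + s *: v) v).
Proof.
move=> Dgd Dp s s01; apply/is_deriv_withinP => e e0.
have [_ H] := Dgd _ (Dp _ s01).
have k0 : 0 < `|v| + 1 by rewrite ltr_wpDl.
have /near_withinP[d d0 Hd] := H _ (divr_gt0 e0 k0).
exists (d / (`|v| + 1)); first exact: divr_gt0.
move=> s'; rewrite /= in_itv/= => s'01 ss.
have E : p + s' *: v - (p + s *: v) = (s' - s) *: v.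
  by rewrite opprD addrACA subrr add0r -scalerBl.
have := Hd _ (Dp _ s'01); rewrite E linearZ/= normrZ => H'.
apply: le_trans (H' _) _.
  apply: (@le_lt_trans _ _ (`|s' - s| * (`|v| + 1))).
    by rewrite ler_wpM2l// lerDl.
  by rewrite -ltr_pdivlMr.
rewrite mulrAC ler_pdivrMr// -mulrA ler_pM2l// ler_wpM2l// lerDl//.
Qed.

Definition locally_lipschitz_at n (r L : R) (x0 : 'rV[R]_n)
    (g : R -> 'rV[R]_n -> 'rV[R]_n) :=
  forall t t' x x', 0 <= t <= r -> 0 <= t' <= r ->
    `|x - x0| <= r -> `|x' - x0| <= r ->
    `|g t x - g t' x'| <= L * (`|t - t'| + `|x - x'|).

(** The evaluations of the first derivative are themselves differentiable, hence bounded near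
    [(0, x0)]. The mean value inequality along segments of the convex set [[0, r]] times a ball
    turns this into a Lipschitz bound. *)
Lemma times_differentiable_lipschitz n m (x0 : 'rV[R]_n)
    (g : R -> 'rV[R]_n -> 'rV[R]_n) :
  times_differentiable m.+2 [set p : R * 'rV[R]_n | 0 <= p.1]
    (fun p => g p.1 p.2) ->
  exists r L : R, [/\ 0 < r, 0 <= L & locally_lipschitz_at r L x0 g].
Proof.
pose D := [set p : R * 'rV[R]_n | 0 <= p.1].
move=> [Dg [gd Dgd]].
have D0 : D (0, x0) by rewrite /D/=.
have bnd v : exists C : R, \forall y \near within D (nbhs (0, x0)), `|Dg y v| <= C.
  have [D2 [D2d _]] := Dgd v.
  exact: frechet_within_bounded (D2d _ D0).
have [C0 C0P] := bnd (1, 0).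
have /choice[C CP] := fun j => bnd (0, delta_mx 0 j).
have /near_withinP[d d0 Hd] : \forall y \near within D (nbhs (0, x0)),
    `|Dg y (1, 0)| <= C0 /\ forall j, `|Dg y (0, delta_mx 0 j)| <= C j.
  by apply: filterI => //;
     apply: (@filter_forall _ _ (fun j y => `|Dg y (0, delta_mx 0 j)| <= C j)
       (within D (nbhs (0, x0))) _ CP).
pose L := `|C0| + \sum_j `|C j|.
have S0 : 0 <= \sum_j `|C j| by apply: sumr_ge0.
have L0 : 0 <= L by rewrite addr_ge0.
(* Half the radius, so that the closed conditions imply the strict ones of [Hd]. *)
exists (d / 2), L; split => //; first by rewrite divr_gt0.
move=> t t' x x' /andP[t0 tr] /andP[t'0 t'r] xr x'r.
have conv s : 0 <= s <= 1 -> 0 <= t' + s * (t - t') <= d / 2.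
  move=> /andP[s0 s1]; have -> : t' + s * (t - t') = s * t + (1 - s) * t' by ring.
  have : 0 <= s * t by rewrite mulr_ge0.
  have : 0 <= (1 - s) * t' by rewrite mulr_ge0// subr_ge0.
  have : s * t <= s * (d / 2) by rewrite ler_wpM2l.
  have : (1 - s) * t' <= (1 - s) * (d / 2) by rewrite ler_wpM2l// subr_ge0.
  lra.
have convx s : 0 <= s <= 1 -> `|x' + s *: (x - x') - x0| <= d / 2.
  move=> /andP[s0 s1].
  have -> : x' + s *: (x - x') - x0 = s *: (x - x0) + (1 - s) *: (x' - x0).
    rewrite scalerBl scale1r !scalerBr; apply/rowP => j; rewrite !mxE; ring.
  apply: le_trans (ler_normD _ _) _; rewrite !normrZ !ger0_norm ?subr_ge0//.
  have : s * `|x - x0| <= s * (d / 2) by rewrite ler_wpM2l.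
  have : (1 - s) * `|x' - x0| <= (1 - s) * (d / 2) by rewrite ler_wpM2l// subr_ge0.
  lra.
have segD s : 0 <= s <= 1 -> D ((t', x') + s *: (t - t', x - x')).
  by move=> /conv /andP[].
have := @mean_value_inequality R _ 0 1 (L * (`|t - t'| + `|x - x'|)) _ _
  (frechet_within_segment gd segD).
move=> /(_ _ 0 1); rewrite /= !scale0r !scale1r !addr0 subr0 normr1 mulr1.
rewrite [t' + _]addrC [x' + _]addrC !subrK !lexx ler01.
move=> H; apply: H => // s s01.
have [] := Hd _ (segD s s01).
  rewrite prod_normE /= gt_max subr0; apply/andP; split.
    have /andP[? ?] := conv _ s01; rewrite ger0_norm//.
    by apply: (@le_lt_trans _ _ (d / 2)) => //; lra.
  by apply: le_lt_trans (convx _ s01) _; lra.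
move=> H0 Hj; rewrite linear_prod_rV.
apply: le_trans (ler_normD _ _) _; rewrite normrZ /L mulrDl.
apply: lerD.
  rewrite mulrC; apply: ler_pM => //; first exact: le_trans H0 (ler_norm _).
  by rewrite lerDl.
apply: le_trans (ler_norm_sum _ _ _) _; rewrite mulr_suml; apply: ler_sum => j _.
rewrite normrZ mulrC; apply: ler_pM => //; first exact: le_trans (Hj j) (ler_norm _).
by apply: le_trans (rV_coord_le _ j) _; rewrite lerDr.
Qed.

End local_lipschitz.

(** * Exact Lie-Trotter splitting *)

Section lie_trotter_estimates.
Context {R : realType} {n : nat}.
Local Notation vec := 'rV[R]_n.
Implicit Types (g : nat -> R -> vec -> vec) (w : nat -> R -> vec).

(** [lie_trotter] with its sub-flows exposed, because the estimates are inductions over the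
    sub-problems. *)
Definition splitting_flow (Lam : nat) g (w0 : vec) (tau : R) w : Prop :=
  [/\ w 1%N 0 = w0,
      forall nu, (2 <= nu <= Lam)%N -> w nu 0 = w nu.-1 tau
    & forall nu, (1 <= nu <= Lam)%N -> ode_solution tau (g nu) (w nu)].

(* Up to time [H], exact splitting started at [c] cannot leave the ball of
   radius [r] on which the fields are controlled. *)
Definition tame_fields (Lam : nat) g (c : vec) (r H M L : R) : Prop :=
  [/\ 0 <= M, 0 <= L, Lam%:R * (M * H) <= r,
      forall nu t x, (1 <= nu <= Lam)%N -> 0 <= t <= H -> `|x - c| <= r ->
        `|g nu t x| < M
    & forall nu t x y, (1 <= nu <= Lam)%N -> 0 <= t <= H ->
        `|x - c| <= r -> `|y - c| <= r -> `|g nu t x - g nu t y| <= L * `|x - y|].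

Lemma ode_solution_deriv (tau : R) (f : R -> vec -> vec) (w : R -> vec) t :
  ode_solution tau f w -> 0 <= t <= tau ->
  is_deriv_within `[0, tau]%classic w t (f t (w t)).
Proof. by move=> sol t0; apply: sol; rewrite in_itv. Qed.

(** A sub-flow that has obeyed the bound so far is still in the ball, where its speed is below [M];
    [growth_bound] closes this circle, and each sub-problem adds at most [M * tau] to the distance
    from [c]. *)
Lemma splitting_flow_confined Lam g c r H M L tau w :
  tame_fields Lam g c r H M L -> 0 <= tau <= H -> splitting_flow Lam g c tau w ->
  forall nu, (nu < Lam)%N ->
    `|w nu.+1 0 - c| <= nu%:R * (M * tau) /\
    forall t, 0 <= t <= tau -> `|w nu.+1 t - w nu.+1 0| <= M * t.
Proof.
move=> [M0 L0 HMr gM _] /andP[tau0 tauH] [w1 wS wsol].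
have Mtau : M * tau <= M * H by rewrite ler_wpM2l.
have step nu : (nu < Lam)%N -> `|w nu.+1 0 - c| <= nu%:R * (M * tau) ->
    forall t, 0 <= t <= tau -> `|w nu.+1 t - w nu.+1 0| <= M * t.
  move=> nuL w0 t ttau; rewrite -[t in M * t]subr0.
  apply: (@growth_bound _ _ 0 tau M _ (fun t => g nu.+1 t (w nu.+1 t))) => // s s0.
    exact: ode_solution_deriv (wsol _ _) _.
  rewrite subr0 => ws; apply: gM => //.
    by case/andP: s0 => ? /le_trans ->//; rewrite andbT.
  have : nu.+1%:R * (M * tau) <= Lam%:R * (M * H).
    by rewrite ler_pM ?mulr_ge0// ler_nat.
  have : M * s <= M * tau by rewrite ler_wpM2l//; case/andP: s0.
  have := ler_distD (w nu.+1 0) (w nu.+1 s) c.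
  rewrite -natr1 mulrDl mul1r; lra.
elim=> [|nu ih] nuL.
  have w0 : `|w 1%N 0 - c| <= 0%:R * (M * tau) by rewrite w1 subrr normr0 mul0r.
  by split => //; exact: step.
have [w0 wt] := ih (ltnW nuL).
have w0' : `|w nu.+2 0 - c| <= nu.+1%:R * (M * tau).
  rewrite wS ?nuL//=; have := wt tau; rewrite tau0 lexx => /(_ isT) H1.
  have := ler_distD (w nu.+1 0) (w nu.+1 tau) c.
  rewrite -[nu.+1%:R]natr1 mulrDl mul1r; lra.
by split => //; exact: step.
Qed.

Lemma splitting_flow_near Lam g c r H M L tau w :
  tame_fields Lam g c r H M L -> 0 <= tau <= H -> splitting_flow Lam g c tau w ->
  forall nu, (nu < Lam)%N -> forall t, 0 <= t <= tau ->
    `|w nu.+1 t - c| <= Lam%:R * (M * tau).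
Proof.
move=> tame tauH fl nu nuL t ttau.
have [w0 wt] := splitting_flow_confined tame tauH fl nuL.
case: tame => M0 _ _ _ _; move/andP: tauH => [tau0 _].
have : M * t <= M * tau by rewrite ler_wpM2l//; case/andP: ttau.
have := wt _ ttau; have := ler_distD (w nu.+1 0) (w nu.+1 t) c.
have : nu.+1%:R * (M * tau) <= Lam%:R * (M * tau).
  by rewrite ler_wpM2r ?mulr_ge0// ler_nat.
by rewrite -natr1 mulrDl mul1r; lra.
Qed.

Lemma splitting_flow_in_ball Lam g c r H M L tau w :
  tame_fields Lam g c r H M L -> 0 <= tau <= H -> splitting_flow Lam g c tau w ->
  forall nu, (nu < Lam)%N -> forall t, 0 <= t <= tau -> `|w nu.+1 t - c| <= r.
Proof.
move=> tame tauH fl nu nuL t ttau.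
apply: le_trans (splitting_flow_near tame tauH fl nuL ttau) _.
have [M0 _ HMr _ _] := tame; case/andP: tauH => _ tauH.
by apply: le_trans HMr; rewrite !ler_wpM2l.
Qed.

(** Every step length has its own chain of sub-flows, so regularity in [tau] requires comparing two
    chains. The difference is carried through each sub-problem, with [2 * (L * H) <= 1] in place of
    a Gronwall exponential. *)
Lemma splitting_flow_stable Lam g c r H M L :
  tame_fields Lam g c r H M L -> 0 <= H -> 2 * (L * H) <= 1 ->
  forall nu, (nu < Lam)%N -> exists2 A : R, 0 <= A &
    forall tau tau' w w', 0 <= tau -> tau < tau' -> tau' <= H ->
      splitting_flow Lam g c tau w -> splitting_flow Lam g c tau' w' ->
      forall t, 0 <= t <= tau -> `|w' nu.+1 t - w nu.+1 t| <= A * (tau' - tau).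
Proof.
move=> tame H0 LH.
have [M0 L0 _ gM gL] := tame.
have step nu A : (nu < Lam)%N -> 0 <= A -> exists2 A' : R, 0 <= A' &
    forall tau tau' w w', 0 <= tau -> tau < tau' -> tau' <= H ->
      splitting_flow Lam g c tau w -> splitting_flow Lam g c tau' w' ->
      `|w' nu.+1 0 - w nu.+1 0| <= A * (tau' - tau) ->
      forall t, 0 <= t <= tau -> `|w' nu.+1 t - w nu.+1 t| <= A' * (tau' - tau).
  (* With [d = tau' - tau], the argument needs [L * (A * d + K * d * H) < K * d]; as [L * H] is at
     most 1/2, any [K] above [2 * (L * A)] will do. *)
  move=> nuL A0; pose K := 2 * (L * A) + 1.
  have LA0 : 0 <= L * A by rewrite mulr_ge0.
  have K0 : 0 < K by rewrite /K; lra.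
  exists (A + K * H); first by rewrite addr_ge0// mulr_ge0// ltW.
  move=> tau tau' w w' tau0 tautau' tau'H fl fl' w0 t ttau.
  pose d := tau' - tau; have d0 : 0 < d by rewrite subr_gt0.
  have Kd0 : 0 < K * d by exact: mulr_gt0.
  have tauH : tau <= H by lra.
  have tau'0 : 0 <= tau' by lra.
  have [_ _ wsol] := fl; have [_ _ wsol'] := fl'.
  pose z s := w' nu.+1 s - w nu.+1 s.
  have zb : forall t, 0 <= t <= tau -> `|z t - z 0| <= K * d * (t - 0).
    apply: (@growth_bound _ _ 0 tau (K * d) z
      (fun t => g nu.+1 t (w' nu.+1 t) - g nu.+1 t (w nu.+1 t))) => s s0.
      apply: is_deriv_withinB.
        apply: (@is_deriv_within_sub _ _ `[0, tau']%classic).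
          by apply: subset_itvl; rewrite bnd_simp ltW.
        apply: ode_solution_deriv (wsol' _ _) _ => //.
        by case/andP: s0 => -> /le_trans -> //; exact: ltW.
      exact: ode_solution_deriv (wsol _ _) _.
    rewrite subr0 => zs; move/andP: s0 => [s0 stau].
    have stau' : s <= tau' by lra.
    have wr : `|w nu.+1 s - c| <= r.
      by apply: (splitting_flow_in_ball tame _ fl) => //; apply/andP; split.
    have wr' : `|w' nu.+1 s - c| <= r.
      by apply: (splitting_flow_in_ball tame _ fl') => //; apply/andP; split.
    apply: le_lt_trans (gL _ _ _ _ _ _ wr' wr) _ => //.
      by rewrite s0 (le_trans stau).
    have zs' : `|z s| <= A * d + K * d * s.
      have := ler_distD (z 0) (z s) 0; rewrite !subr0 /d => h; apply: le_trans h _.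
      by rewrite addrC lerD.
    have : L * `|z s| <= L * (A * d + K * d * s) by rewrite ler_wpM2l.
    have : L * (A * d + K * d * s) <= L * (A * d + K * d * H).
      rewrite ler_wpM2l// lerD2l ler_pM2l//; lra.
    have : (2 * (L * H)) * (K * d) <= 1 * (K * d) by rewrite ler_pM2r.
    have : K * d = 2 * (L * A) * d + d by rewrite /K; ring.
    rewrite -/(z s); lra.
  have := zb t ttau; have := ler_distD (z 0) (z t) 0; rewrite !subr0 -/(z t) -/d.
  have : K * d * t <= K * d * H.
    by rewrite ler_pM2l//; case/andP: ttau; lra.
  rewrite -/(z 0) -/d in w0; lra.
elim=> [|nu ih] nuL.
  have [A' A'0 HA'] := step 0%N 0 nuL (lexx 0).
  exists A' => // tau tau' w w' tau0 tt tH fl fl'; apply: HA' => //.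
  by case: fl => -> _ _; case: fl' => -> _ _; rewrite subrr normr0 mul0r.
have [A A0 HA] := ih (ltnW nuL).
(* The next initial values differ by the inherited [A] part and by the extra run of the longer
   sub-flow from [tau] to [tau'], at speed at most [M]. *)
have [A' A'0 HA'] := step nu.+1 (M + A) nuL (addr_ge0 M0 A0).
exists A' => // tau tau' w w' tau0 tt tH fl fl'; apply: HA' => //.
have [_ wS _] := fl; have [_ wS' wsol'] := fl'.
rewrite wS ?nuL// wS' ?nuL//=.
have h1 : `|w' nu.+1 tau - w nu.+1 tau| <= A * (tau' - tau).
  by apply: HA => //; rewrite tau0 lexx.
have h2 : `|w' nu.+1 tau' - w' nu.+1 tau| <= M * `|tau' - tau|.
  apply: (@mean_value_inequality _ _ 0 tau' M _ (fun t => g nu.+1 t (w' nu.+1 t))).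
  - by move=> s s0; apply: ode_solution_deriv (wsol' _ _) _ => //; exact: ltnW.
  - move=> s s0; have ? : `|w' nu.+1 s - c| <= r.
      apply: (splitting_flow_in_ball tame _ fl') => //; [lra|exact: ltnW].
    apply/ltW/gM => //; last lra.
    exact: ltnW.
  - lra.
  - lra.
rewrite gtr0_norm ?subr_gt0// in h2.
have := ler_distD (w' nu.+1 tau) (w' nu.+1 tau') (w nu.+1 tau).
rewrite mulrDl; lra.
Qed.

Lemma lie_trotter_lipschitz Lam g c r H M L :
  (0 < Lam)%N -> tame_fields Lam g c r H M L -> 0 <= H -> 2 * (L * H) <= 1 ->
  exists2 A : R, 0 <= A & forall tau tau' y y', 0 <= tau -> tau < tau' -> tau' <= H ->
    lie_trotter Lam g c tau y -> lie_trotter Lam g c tau' y' ->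
    `|y' - y| <= A * (tau' - tau).
Proof.
case: Lam => // Lam _ tame H0 LH.
have [A A0 HA] := splitting_flow_stable tame H0 LH (ltnSn Lam).
have [M0 L0 _ gM gL] := tame.
exists (M + A); first exact: addr_ge0.
move=> tau tau' y y' tau0 tt tH [w [w1 wS wsol ->]] [w' [w1' wS' wsol' ->]].
have h1 : `|w' Lam.+1 tau - w Lam.+1 tau| <= A * (tau' - tau).
  by apply: HA => //; rewrite tau0 lexx.
have h2 : `|w' Lam.+1 tau' - w' Lam.+1 tau| <= M * `|tau' - tau|.
  apply: (@mean_value_inequality _ _ 0 tau' M _ (fun t => g Lam.+1 t (w' Lam.+1 t))).
  - by move=> s s0; apply: ode_solution_deriv (wsol' _ _) _ => //=.
  - move=> s s0; have ? : `|w' Lam.+1 s - c| <= r.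
      apply: (@splitting_flow_in_ball _ _ _ _ _ _ _ tau' w' tame) => //; lra.
    apply/ltW/gM => //=; lra.
  - lra.
  - lra.
rewrite gtr0_norm ?subr_gt0// in h2.
have := ler_distD (w' Lam.+1 tau) (w' Lam.+1 tau') (w Lam.+1 tau).
rewrite mulrDl; lra.
Qed.

Lemma lie_trotter_near Lam g c r H M L tau y :
  (0 < Lam)%N -> tame_fields Lam g c r H M L -> 0 <= tau <= H ->
  lie_trotter Lam g c tau y -> `|y - c| <= Lam%:R * (M * tau).
Proof.
case: Lam => // Lam _ tame tauH [w [w1 wS wsol ->]].
apply: (@splitting_flow_near _ _ _ _ _ _ _ tau w tame) => //.
by case/andP: tauH => ->; rewrite lexx.
Qed.

End lie_trotter_estimates.

(** * Orders of the splitting results in the step length *)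

Section lie_trotter_order.
Context {R : realType} {n : nat}.
Local Notation vec := 'rV[R]_n.
Implicit Types (g : nat -> R -> vec -> vec) (w : nat -> R -> vec).

(** Source of the order gained by a correction: a forcing of size [eta] acting for a time [tau] from
    the value 0 produces [eta * tau]. [A] is chosen before the fields, since the error fields vary
    with [h]. *)
Lemma lie_trotter_small Lam L : (0 < Lam)%N -> 0 <= L ->
  exists2 A : R, 0 <= A & forall g r H M eta tau y,
    tame_fields Lam g 0 r H M L -> H <= 1 -> 2 * (L * H) <= 1 ->
    0 < eta -> 0 <= tau <= H ->
    (forall nu t x, (1 <= nu <= Lam)%N -> 0 <= t <= tau -> `|x| <= r ->
       `|g nu t x| <= L * (`|x| + eta)) ->
    lie_trotter Lam g 0 tau y -> `|y| <= A * (eta * tau).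
Proof.
move=> Lam0 L0.
have step nu : (nu < Lam)%N -> exists2 A : R, 0 <= A &
    forall g r H M eta tau w, tame_fields Lam g 0 r H M L -> H <= 1 ->
    2 * (L * H) <= 1 -> 0 < eta -> 0 <= tau <= H ->
    (forall nu t x, (1 <= nu <= Lam)%N -> 0 <= t <= tau -> `|x| <= r ->
       `|g nu t x| <= L * (`|x| + eta)) ->
    splitting_flow Lam g 0 tau w -> `|w nu.+1 tau| <= A * (eta * tau).
  have one nu' A : (nu' < Lam)%N -> 0 <= A -> exists2 A' : R, 0 <= A' &
    forall g r H M eta tau w, tame_fields Lam g 0 r H M L -> H <= 1 ->
    2 * (L * H) <= 1 -> 0 < eta -> 0 <= tau <= H ->
    (forall nu t x, (1 <= nu <= Lam)%N -> 0 <= t <= tau -> `|x| <= r ->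
       `|g nu t x| <= L * (`|x| + eta)) ->
    splitting_flow Lam g 0 tau w -> `|w nu'.+1 0| <= A * (eta * tau) ->
    `|w nu'.+1 tau| <= A' * (eta * tau).
    (* After division by [eta], and with [tau <= 1], the speed is at most [L * (A + K * H + 1)];
       this is below [K] because [L * H] is at most 1/2. *)
    move=> nuL A0; pose K := 2 * (L * A) + 2 * L + 1.
    have LA0 : 0 <= L * A by rewrite mulr_ge0.
    have K0 : 0 < K by rewrite /K; lra.
    exists (A + K); first by rewrite addr_ge0// ltW.
    move=> g r H M eta tau w tame H1 LH eta0 /andP[tau0 tauH] gs fl w0.
    have [_ _ wsol] := fl.
    have tauI : 0 <= tau <= tau by rewrite tau0 lexx.
    suff : `|w nu'.+1 tau - w nu'.+1 0| <= K * eta * (tau - 0).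
      have := ler_distD (w nu'.+1 0) (w nu'.+1 tau) 0; rewrite !subr0.
      by move=> h1 h2; lra.
    apply: (@growth_bound _ _ 0 tau (K * eta) _
      (fun t => g nu'.+1 t (w nu'.+1 t))) => // s s0.
      exact: ode_solution_deriv (wsol _ _) _.
    rewrite subr0 => ws.
    have wr : `|w nu'.+1 s| <= r.
      rewrite -[w _ _]subr0; apply: (splitting_flow_in_ball tame _ fl) => //.
      by rewrite tau0.
    apply: le_lt_trans (gs _ _ _ _ s0 wr) _ => //.
    have Ke : 0 < K * eta by exact: mulr_gt0.
    have ws' : `|w nu'.+1 s| <= A * (eta * tau) + K * eta * s.
      have := ler_distD (w nu'.+1 0) (w nu'.+1 s) 0; rewrite !subr0; lra.
    have : L * (`|w nu'.+1 s| + eta) <= L * (A * (eta * 1) + K * eta * H + eta).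
      rewrite ler_wpM2l// lerD2r; apply: le_trans ws' _; apply: lerD.
        rewrite ler_wpM2l// ler_pM2l//; lra.
      by rewrite ler_pM2l//; case/andP: s0; lra.
    have : (2 * (L * H)) * (K * eta) <= 1 * (K * eta) by rewrite ler_pM2r.
    have : K * eta = 2 * (L * A) * eta + 2 * L * eta + eta by rewrite /K; ring.
    lra.
  elim: nu => [|nu ih] nuL.
    have [A A0 HA] := one 0%N 0 nuL (lexx 0).
    exists A => // g r H M eta tau w tame H1 LH eta0 tauH gs fl.
    apply: (HA _ _ _ _ _ _ _ tame) => //.
    by case: fl => -> _ _; rewrite normr0 mul0r.
  have [A A0 HA] := ih (ltnW nuL).
  have [A' A'0 HA'] := one nu.+1 A nuL A0.
  exists A' => // g r H M eta tau w tame H1 LH eta0 tauH gs fl.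
  apply: (HA' _ _ _ _ _ _ _ tame) => //.
  by have [_ wS _] := fl; rewrite wS ?nuL//; exact: (HA _ _ _ _ _ _ _ tame).
case: Lam Lam0 step => // Lam _ step.
have [A A0 HA] := step Lam (ltnSn Lam).
exists A => // g r H M eta tau y tame H1 LH eta0 tauH gs [w [w1 wS wsol ->]].
exact: (HA _ _ _ _ _ _ _ tame).
Qed.

(** Each field is compared with its frozen value at [(0, c)]: along the splitting, time and distance
    from [c] are both O(tau), so each sub-problem contributes an error O(tau^2). *)
Lemma lie_trotter_consistent Lam g c r H M L :
  (0 < Lam)%N -> tame_fields Lam g c r H M L ->
  (forall nu t x, (1 <= nu <= Lam)%N -> 0 <= t <= H -> `|x - c| <= r ->
     `|g nu t x - g nu 0 c| <= L * (t + `|x - c|)) ->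
  exists2 A : R, 0 <= A & forall tau y, 0 <= tau <= H ->
    lie_trotter Lam g c tau y ->
    `|y - c - tau *: total_field Lam g 0 c| <= A * tau ^+ 2.
Proof.
move=> Lam0 tame gL; have [M0 L0 _ _ _] := tame.
(* From [t <= tau] and [|x - c| <= Lam * (M * tau)] along every sub-flow. *)
pose C := L * (1 + Lam%:R * M).
have C0 : 0 <= C by rewrite mulr_ge0// addr_ge0// mulr_ge0.
exists (Lam%:R * C); first by rewrite mulr_ge0.
have main tau w : 0 <= tau <= H -> splitting_flow Lam g c tau w ->
    forall nu, (nu < Lam)%N ->
    `|w nu.+1 tau - c - tau *: (\sum_(1 <= i < nu.+2) g i 0 c)| <=
      nu.+1%:R * C * tau ^+ 2.
  move=> tauH fl; have [w1 wS wsol] := fl; have [tau0 tauH'] := andP tauH.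
  have one nu : (nu < Lam)%N ->
      `|w nu.+1 tau - w nu.+1 0 - tau *: g nu.+1 0 c| <= C * tau ^+ 2.
    move=> nuL; have := @mean_value_inequality _ _ 0 tau (C * tau)
      (fun t => w nu.+1 t - t *: g nu.+1 0 c)
      (fun t => g nu.+1 t (w nu.+1 t) - g nu.+1 0 c).
    move=> /(_ _ _ 0 tau); rewrite scale0r !subr0 tau0 lexx/= ger0_norm//.
    rewrite [X in `|X| <= _]addrAC -mulrA -expr2; apply => // s s0.
      apply: is_deriv_withinB; last exact: is_deriv_within_linear.
      exact: ode_solution_deriv (wsol _ _) _.
    have [s0' stau] := andP s0.
    have wn := splitting_flow_near tame tauH fl nuL s0.
    apply: le_trans (gL _ _ _ _ _ _) _ => //.
    - by rewrite s0' (le_trans stau).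
    - exact: splitting_flow_in_ball tame tauH fl _ nuL _ s0.
    - rewrite /C -mulrA ler_wpM2l//; lra.
  elim=> [|nu ih] nuL.
    by have := one 0%N nuL; rewrite w1 big_nat1 mul1r.
  have h1 := ih (ltnW nuL); have := one nu.+1 nuL.
  rewrite wS ?nuL//= big_nat_recr//= scalerDr => h2.
  have -> : w nu.+2 tau - c -
      (tau *: (\sum_(1 <= i < nu.+2) g i 0 c) + tau *: g nu.+2 0 c) =
    (w nu.+1 tau - c - tau *: (\sum_(1 <= i < nu.+2) g i 0 c)) +
    (w nu.+2 tau - w nu.+1 tau - tau *: g nu.+2 0 c).
    by apply/rowP => j; rewrite !mxE; ring.
  apply: le_trans (ler_normD _ _) _.
  rewrite -[nu.+2%:R]natr1; lra.
case: Lam Lam0 tame gL @C C0 main => // Lam _ tame gL C C0 main.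
move=> tau y tauH [w [w1 wS wsol ->]].
by apply: (main tau w tauH _ Lam).
Qed.

End lie_trotter_order.

(** * Prediction and correction *)

Section idc_step.
Context {R : realType} {n : nat}.
Local Notation vec := 'rV[R]_n.

(** On the single point [[0, 0]] any vector is a relative derivative. Time 0 can thus be treated
    together with the positive steps. *)
Lemma lie_trotter0 Lam (g : nat -> R -> vec -> vec) (c : vec) :
  lie_trotter Lam g c 0 c.
Proof.
exists (fun _ _ => c); split => // nu _ t.
rewrite in_itv/= => t0; apply/is_deriv_withinP => e e0; exists 1 => // s.
have -> : t = 0 by apply/le_anti; rewrite andbC.
rewrite /= in_itv/= => s0; have -> : s = 0 by apply/le_anti; rewrite andbC.
by rewrite !subrr scale0r subrr !normr0 mulr0.
Qed.

Lemma locally_lipschitz_at_weaken (r L r' L' : R) (x0 : vec) (g : R -> vec -> vec) :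
  r' <= r -> L <= L' -> locally_lipschitz_at r L x0 g ->
  locally_lipschitz_at r' L' x0 g.
Proof.
move=> rr LL H t t' x x' /andP[t0 tr] /andP[t'0 t'r] xr x'r.
apply: le_trans (H t t' x x' _ _ _ _) _; rewrite ?t0 ?t'0/=; [lra..|].
by rewrite ler_wpM2r// addr_ge0.
Qed.

Lemma locally_lipschitz_uniform Lam (f : nat -> R -> vec -> vec) (x0 : vec) :
  (forall nu, (1 <= nu <= Lam)%N ->
    exists r L, [/\ 0 < r, 0 <= L & locally_lipschitz_at r L x0 (f nu)]) ->
  exists r L, [/\ 0 < r, 0 <= L & forall nu, (1 <= nu <= Lam)%N ->
    locally_lipschitz_at r L x0 (f nu)].
Proof.
elim: Lam => [|Lam ih] H; first by exists 1, 1; split => // nu /andP[/leq_trans h /h].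
have [nu /andP[n1 nL]|r [L [r0 L0 rL]]] := ih; first by apply: H; rewrite n1 leqW.
have [|r' [L' [r'0 L'0 rL']]] := H Lam.+1; first by rewrite leqnn.
exists (Num.min r r'), (Num.max L L'); split.
- by rewrite lt_min r0.
- by rewrite le_max L0.
move=> nu /andP[n1]; rewrite leq_eqVlt => /predU1P[->|nL].
  by apply: locally_lipschitz_at_weaken rL'; rewrite ?ge_min ?le_max lexx orbT.
by apply: locally_lipschitz_at_weaken (rL _ _); rewrite ?ge_min ?le_max ?lexx ?n1.
Qed.

Lemma total_field_lipschitz Lam (f : nat -> R -> vec -> vec) (x0 : vec) r L :
  (forall nu, (1 <= nu <= Lam)%N -> locally_lipschitz_at r L x0 (f nu)) ->
  locally_lipschitz_at r (Lam%:R * L) x0 (total_field Lam f).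
Proof.
move=> H t t' x x' tr t'r xr x'r; rewrite /total_field -sumrB.
apply: le_trans (ler_norm_sum _ _ _) _.
rewrite -mulrA mulr_natl -[Lam in _ *+ Lam]subn0 -[(Lam - 0)%N]/(Lam.+1 - 1)%N.
rewrite -sumr_const_nat; apply: ler_sum_nat => nu nuL; exact: H.
Qed.

(* The error bound after [k] corrections; the Lipschitz constant, unlike [C], may
   depend on [h]. *)
Definition approximates (u0 : vec) (u : R -> vec) (k : nat) (h C : R) (v : R -> vec) :=
  [/\ v 0 = u0, exists2 K, 0 <= K & lipschitz_itv h K v
    & forall t, 0 <= t <= h -> `|u t - v t| <= C * t ^+ k.+2].

End idc_step.

Section idc_correction.
Context {R : realType} {n : nat}.
Local Notation vec := 'rV[R]_n.

(* [y] is the Picard iterate [u0 + int_0 F(s, v s) ds]; the residual of [v]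
   integrates to [v - y], and [y] is one order closer to [u] than [v] is. *)
Lemma picard_residual (F : R -> vec -> vec) (u0 : vec) (u v : R -> vec)
    (r L h K C : R) (k : nat) :
  0 < h -> h <= r -> 0 <= L -> 0 <= K -> 0 <= C ->
  locally_lipschitz_at r L u0 F -> u 0 = u0 -> v 0 = u0 -> ode_solution h F u ->
  (forall t, 0 <= t <= h -> `|u t - u0| <= r) ->
  (forall t, 0 <= t <= h -> `|v t - u0| <= r) ->
  lipschitz_itv h K v ->
  (forall t, 0 <= t <= h -> `|u t - v t| <= C * t ^+ k) ->
  exists y : R -> vec, [/\ y 0 = u0, exists2 K', 0 <= K' & lipschitz_itv h K' y,
    forall t, 0 <= t <= h -> int_residual F h v t = v t - y t
  & forall t, 0 <= t <= h -> `|u t - y t| <= L * C * t ^+ k.+1].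
Proof.
move=> h0 hr L0 K0 C0 FL ui vi usol ur vr vlip err.
pose a s := F s (v s); pose I t := vec_integral t a.
have tr t : 0 <= t <= h -> 0 <= t <= r by move=> /andP[-> th]; exact: le_trans hr.
have alip : lipschitz_itv h (L * (1 + K)) a.
  move=> s t s0 t0.
  apply: le_trans (FL _ _ _ _ (tr _ s0) (tr _ t0) (vr _ s0) (vr _ t0)) _.
  by rewrite -mulrA ler_wpM2l// mulrDl mul1r lerD2l; exact: vlip.
have LK0 : 0 <= L * (1 + K) by rewrite mulr_ge0// addr_ge0.
have dI t : 0 <= t <= h -> is_deriv_within `[0, h]%classic I t (a t).
  by move=> t0; exact: vec_integral_deriv (ltW h0) LK0 alip t0.
have I0 : I 0 = 0.
  by apply/rowP => j; rewrite !mxE set_itv1 Rintegral_set1.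
have zero_in : 0 <= (0 : R) <= h by rewrite lexx ltW.
exists (fun t => u0 + I t); split.
- by rewrite I0 addr0.
- pose M := `|a 0| + L * (1 + K) * h.
  have M0 : 0 <= M by rewrite addr_ge0// mulr_ge0// ltW.
  exists M => // s t s0 t0; rewrite opprD addrACA subrr add0r.
  apply: (mean_value_inequality dI) => // x x0; rewrite /M.
  rewrite -[a x](subrK (a 0)) addrC; apply: le_trans (ler_normD _ _) _.
  rewrite lerD2l; apply: le_trans (alip _ _ x0 zero_in) _.
  by rewrite subr0; case/andP: x0 => x0 xh; rewrite ger0_norm// ler_wpM2l.
- move=> t t0; rewrite (int_residualE h0 K0 vlip LK0 alip t0) vi.
  by rewrite opprD addrA.
move=> t t0h; have /andP[t0 th] := t0h.
(* The derivative of [u - I] is [F s (u s) - F s (v s)], bounded on [[0, t]] by [L * C * t ^+ k];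
   integrating over length [t] gains one power. *)
have := @mean_value_inequality _ _ 0 t (L * C * t ^+ k) (fun t => u t - I t)
  (fun s => F s (u s) - a s).
move=> /(_ _ _ 0 t); rewrite ui I0 !subr0 lexx t0/= ger0_norm//.
rewrite (exprSr t k) (mulrA _ (t ^+ _) t).
rewrite (_ : u t - I t - u0 = u t - (u0 + I t)); last first.
  by rewrite opprD addrA addrAC.
apply => // s /andP[s0 st]; have s0h : 0 <= s <= h by rewrite s0 (le_trans st).
  apply: (@is_deriv_within_sub _ _ `[0, h]%classic).
    by apply: subset_itvl; rewrite bnd_simp.
  by apply: is_deriv_withinB; [exact: ode_solution_deriv usol _|exact: dI].
apply: le_trans (FL _ _ _ _ (tr _ s0h) (tr _ s0h) (ur _ s0h) (vr _ s0h)) _.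
rewrite subrr normr0 add0r -mulrA ler_wpM2l//.
apply: le_trans (err _ s0h) _; rewrite ler_wpM2l//.
by rewrite lerXn2r ?nnegrE.
Qed.

(** The two arguments of [f nu] differ by [x] minus the integrated residual. The three bounds by
    [r / 4] keep both arguments in the ball of radius [r] about [u0]. *)
Lemma error_field_small Lam (f : nat -> R -> vec -> vec) (u0 : vec)
    (v : R -> vec) (r L h : R) :
  0 < h -> h <= r -> 0 <= L ->
  (forall nu, (1 <= nu <= Lam)%N -> locally_lipschitz_at r L u0 (f nu)) ->
  (forall t, 0 <= t <= h -> `|v t - u0| <= r / 4) ->
  (forall t, 0 <= t <= h -> `|int_residual (total_field Lam f) h v t| <= r / 4) ->
  forall nu t x, (1 <= nu <= Lam)%N -> 0 <= t <= h -> `|x| <= r / 4 ->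
    `|error_field Lam f h v nu t x| <=
      L * (`|x| + `|int_residual (total_field Lam f) h v t|).
Proof.
move=> h0 hr L0 fL vr Er nu t x nuL t0h xr; rewrite /error_field.
have t0r : 0 <= t <= r by case/andP: t0h => -> th; exact: le_trans hr.
have := vr t t0h; have := Er t t0h; set E := int_residual _ _ _ _ => Er' vr'.
have xE : `|x - E| <= `|x| + `|E| by exact: ler_normB.
apply: le_trans (fL _ nuL _ _ _ _ t0r t0r _ _) _.
- rewrite (_ : v t + x - E - u0 = (v t - u0) + (x - E)); last first.
    by apply/rowP => j; rewrite !mxE; ring.
  apply: le_trans (ler_normD _ _) _; clear -xE xr Er' vr' h0 hr; lra.
- clear -vr' hr h0; lra.
rewrite subrr normr0 add0r (_ : v t + x - E - v t = x - E) ?ler_wpM2l//.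
by apply/rowP => j; rewrite !mxE; ring.
Qed.

Lemma error_field_tame Lam (f : nat -> R -> vec -> vec) (u0 : vec)
    (v : R -> vec) (r L h : R) :
  0 < h -> h <= r -> 0 <= L ->
  (forall nu, (1 <= nu <= Lam)%N -> locally_lipschitz_at r L u0 (f nu)) ->
  (forall t, 0 <= t <= h -> `|v t - u0| <= r / 4) ->
  (forall t, 0 <= t <= h -> `|int_residual (total_field Lam f) h v t| <= r / 4) ->
  Lam%:R * ((L * r + 1) * h) <= r / 4 ->
  tame_fields Lam (error_field Lam f h v) 0 (r / 4) h (L * r + 1) L.
Proof.
move=> h0 hr L0 fL vr Er hL.
have r0 : 0 < r by exact: lt_le_trans hr.
split => //; first by rewrite addr_ge0// mulr_ge0// ltW.
  move=> nu t x nuL t0h; rewrite subr0 => xr.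
  apply: le_lt_trans (error_field_small h0 hr L0 fL vr Er nuL t0h xr) _.
  rewrite ltr_pwDr// ler_wpM2l//; have := Er t t0h.
  by clear -xr r0; lra.
move=> nu t x y nuL t0h; rewrite !subr0 => xr yr; rewrite /error_field.
have t0r : 0 <= t <= r by case/andP: t0h => -> th; exact: le_trans hr.
have := vr t t0h; have := Er t t0h; set E := int_residual _ _ _ _ => Er' vr'.
have ball q : `|q| <= r / 4 -> `|v t + q - E - u0| <= r.
  move=> qr; rewrite (_ : _ - u0 = (v t - u0) + (q - E)); last first.
    by apply/rowP => j; rewrite !mxE; ring.
  apply: le_trans (ler_normD _ _) _; have := ler_normB q E.
  by clear -qr Er' vr' r0; lra.
rewrite (_ : _ - (_ - f nu t (v t)) =
    f nu t (v t + x - E) - f nu t (v t + y - E)); last first.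
  by apply/rowP => j; rewrite !mxE; ring.
apply: le_trans (fL _ nuL _ _ _ _ t0r t0r (ball _ xr) (ball _ yr)) _.
rewrite subrr normr0 add0r (_ : _ - (v t + y - E) = x - y) ?ler_wpM2l//.
by apply/rowP => j; rewrite !mxE; ring.
Qed.

End idc_correction.

Section idc_order.
Context {R : realType} {n : nat}.
Local Notation vec := 'rV[R]_n.

(** Imposes a finite list of smallness conditions on [h] at once, each brought to the form
    [h * x <= 1]. *)
Lemma exists_small (s : seq R) : all (fun x => 0 <= x) s ->
  exists2 h0 : R, 0 < h0 & forall h, 0 < h <= h0 -> all (fun x => h * x <= 1) s.
Proof.
elim: s => [|x s ih] /=; first by exists 1.
move=> /andP[x0 /ih[h0 h00 H]].
exists (Num.min h0 (1 + x)^-1); first by rewrite lt_min h00 invr_gt0 ltr_pwDl.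
move=> h /andP[hp]; rewrite le_min => /andP[hh0 hx]; apply/andP; split; last first.
  by apply: H; rewrite hp.
apply: (@le_trans _ _ ((1 + x)^-1 * (1 + x))); last by rewrite mulVf// gt_eqF// ltr_pwDl.
by apply: ler_pM => //; [exact: ltW|rewrite lerDr].
Qed.

(** Serves the prediction with [y = 0] and the corrections with [y] the Picard iterate; the
    regularity obtained lets the next residual be integrated. *)
Lemma lipschitz_itv_splitting Lam (g : nat -> R -> vec -> vec) (c : vec)
    (r h M L K : R) (y v : R -> vec) :
  (0 < Lam)%N -> tame_fields Lam g c r h M L -> 0 <= h -> 2 * (L * h) <= 1 ->
  0 <= K -> lipschitz_itv h K y ->
  (forall t, 0 <= t <= h -> exists2 Q, lie_trotter Lam g c t Q & v t = y t + Q) ->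
  exists2 K', 0 <= K' & lipschitz_itv h K' v.
Proof.
move=> Lam0 tame h0 hL K0 ylip vE.
have [A A0 HA] := lie_trotter_lipschitz Lam0 tame h0 hL.
exists (K + A); first exact: addr_ge0.
have main s t : 0 <= s <= h -> 0 <= t <= h -> s < t ->
    `|v t - v s| <= (K + A) * `|t - s|.
  move=> s0h t0h st; have [Q QL ->] := vE t t0h; have [Q' QL' ->] := vE s s0h.
  rewrite opprD addrACA mulrDl; apply: le_trans (ler_normD _ _) _.
  apply: lerD; first exact: ylip.
  rewrite gtr0_norm ?subr_gt0//; apply: HA QL' QL => //.
    by case/andP: s0h.
  by case/andP: t0h.
move=> s t s0h t0h; case: (ltgtP s t) => [st|ts|->].
- by rewrite distrC [`|s - t|]distrC; exact: main.
- exact: main.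
- by rewrite !subrr !normr0 mulr0.
Qed.

(** With [v' = y + Q], the error splits into [u - y], bounded by [picard_residual], and [Q], bounded
    by [lie_trotter_small]. [C'] and [h0] precede [h], which keeps the estimate uniform. *)
Lemma approximates_correction Lam (f : nat -> R -> vec -> vec) (u0 : vec)
    (u : R -> vec) (r L H M : R) :
  (0 < Lam)%N -> 0 < r -> 0 <= L -> 0 < H -> 0 <= M ->
  (forall nu, (1 <= nu <= Lam)%N -> locally_lipschitz_at r L u0 (f nu)) ->
  u 0 = u0 -> ode_solution H (total_field Lam f) u ->
  (forall t, 0 <= t <= H -> `|u t - u0| <= M * t) ->
  forall k C, 0 <= C -> exists2 C', 0 <= C' & exists2 h0, 0 < h0 &
    forall h v v', 0 < h <= h0 -> approximates u0 u k h C v -> v' 0 = u0 ->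
    (forall tau, 0 < tau <= h -> exists2 Q : vec,
       lie_trotter Lam (error_field Lam f h v) 0 tau Q
     & v' tau = v tau + Q - int_residual (total_field Lam f) h v tau) ->
    approximates u0 u k.+1 h C' v'.
Proof.
move=> Lam0 r0 L0 H0 M0 fL ui usol uM k C C0.
set F := total_field Lam f; pose LF := Lam%:R * L.
have FL : locally_lipschitz_at r LF u0 F by exact: total_field_lipschitz.
have LF0 : 0 <= LF by rewrite mulr_ge0.
(* Constant for [v - y = (v - u) + (u - y)] at times at most 1; the summand 1 makes it positive, as
   [eta] must be. *)
pose CE := C + LF * C + 1.
have LFC0 : 0 <= LF * C by exact: mulr_ge0.
have CE0 : 0 < CE by rewrite ltr_pwDr// addr_ge0.
pose MG := L * r + 1.
have MG0 : 0 <= MG by rewrite addr_ge0// mulr_ge0// ltW.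
have [A A0 HA] := @lie_trotter_small R n Lam L Lam0 L0.
exists (LF * C + A * CE); first by rewrite addr_ge0// mulr_ge0// ltW.
have r4 : 0 < r / 4 by rewrite divr_gt0.
(* In order: [h <= 1], [h <= H], [h <= r]; [u] and [v] within [r / 4] of [u0]; integrated residual
   at most [r / 4]; confinement of the error splitting; and [2 * L * h <= 1] for the comparison
   arguments. *)
have [|h0 h00 small] := @exists_small
  [:: 1; H^-1; r^-1; (C + M) / (r / 4); CE / (r / 4); Lam%:R * MG / (r / 4); 2 * L].
  have i0 : 0 <= (r / 4)^-1 by rewrite invr_ge0 ltW.
  have CM0 : 0 <= C + M by exact: addr_ge0.
  have LMG : 0 <= Lam%:R * MG by exact: mulr_ge0.
  rewrite /= !invr_ge0 (ltW H0) (ltW r0) (mulr_ge0 CM0 i0) (mulr_ge0 (ltW CE0) i0).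
  by rewrite (mulr_ge0 LMG i0) mulr_ge0// ler01.
exists h0 => // h v v' hh0 [v0 [K K0 vlip] verr] v'0 v'E.
have /and5P[h1 hH hr hCM /and4P[hCE hMG hL _]] := small h hh0.
have {hh0} h0' : 0 < h by case/andP: hh0.
rewrite mulr1 in h1; rewrite ler_pdivrMr// mul1r in hH hr.
rewrite ler_pdivrMr// mul1r in hr.
rewrite mulrA ler_pdivrMr// mul1r in hCM.
rewrite mulrA ler_pdivrMr// mul1r in hCE.
rewrite mulrA ler_pdivrMr// mul1r in hMG.
have hL' : 2 * (L * h) <= 1 by rewrite mulrA mulrC.
have powle t m : 0 <= t <= h -> t ^+ m.+1 <= t.
  move=> /andP[t0 th]; rewrite exprS -[leRHS]mulr1 ler_wpM2l// exprn_ile1//.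
  exact: le_trans h1.
have in_H t : 0 <= t <= h -> 0 <= t <= H by move=> /andP[-> /le_trans]; apply.
have ur t : 0 <= t <= h -> `|u t - u0| <= r / 4.
  move=> t0h; apply: le_trans (uM _ (in_H _ t0h)) _; apply: le_trans hCM.
  rewrite mulrC; apply: ler_pM => //; [by case/andP: t0h..|by rewrite lerDr].
have vr t : 0 <= t <= h -> `|v t - u0| <= r / 4.
  move=> t0h; have /andP[t0 th] := t0h; apply: le_trans (ler_distD (u t) _ _) _.
  apply: le_trans hCM; rewrite mulrDr; apply: lerD.
    rewrite distrC; apply: le_trans (verr t t0h) _; rewrite mulrC ler_wpM2r//.
    exact: le_trans (powle _ _ t0h) th.
  by apply: le_trans (uM _ (in_H _ t0h)) _; rewrite mulrC ler_wpM2r.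
have le4 : r / 4 <= r by clear -r0; lra.
have usol' : ode_solution h F u.
  move=> t; rewrite in_itv/= => t0h.
  apply: (@is_deriv_within_sub _ _ `[0, H]%classic).
    by apply: subset_itvl; rewrite bnd_simp.
  exact: ode_solution_deriv usol (in_H _ t0h).
have [y [y0 [K' K'0 ylip] Ey yerr]] := picard_residual h0' hr LF0 K0 C0 FL ui v0 usol'
  (fun t t0 => le_trans (ur t t0) le4) (fun t t0 => le_trans (vr t t0) le4) vlip verr.
have Ebound t : 0 <= t <= h -> `|int_residual F h v t| <= CE * t ^+ k.+2.
  move=> t0h; have /andP[t0 th] := t0h; rewrite Ey//.
  apply: le_trans (ler_distD (u t) _ _) _; rewrite [`|v t - _|]distrC.
  have tk0 : 0 <= t ^+ k.+2 by rewrite exprn_ge0.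
  apply: (@le_trans _ _ (C * t ^+ k.+2 + LF * C * t ^+ k.+2)).
    apply: lerD; first exact: verr.
    apply: le_trans (yerr t t0h) _; rewrite ler_wpM2l// exprS ler_piMl//.
    exact: le_trans h1.
  by rewrite -mulrDl ler_wpM2r// /CE lerDl.
have Er t : 0 <= t <= h -> `|int_residual F h v t| <= r / 4.
  move=> t0h; apply: le_trans (Ebound t t0h) _; apply: le_trans hCE.
  rewrite mulrC ler_pM2r//; apply: le_trans (powle _ _ t0h) _.
  by case/andP: t0h.
have hMG' : Lam%:R * (MG * h) <= r / 4 by rewrite mulrA mulrC.
have tame := error_field_tame h0' hr L0 fL vr Er hMG'.
have Gs := error_field_small h0' hr L0 fL vr Er.
have v'Q t : 0 <= t <= h ->
    exists2 Q, lie_trotter Lam (error_field Lam f h v) 0 t Q & v' t = y t + Q.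
  move=> t0h; have /andP[t0 th] := t0h.
  have [->|t00] := eqVneq t 0.
    by exists 0; [exact: lie_trotter0|rewrite v'0 y0 addr0].
  have [|Q QL ->] := v'E t; first by rewrite lt_neqAle eq_sym t00 t0.
  by exists Q => //; rewrite Ey// opprB addrC addrA subrK.
split => //; first exact: lipschitz_itv_splitting tame (ltW h0') hL' K'0 ylip v'Q.
move=> t t0h; have /andP[t0 th] := t0h.
have [->|t00] := eqVneq t 0.
  by rewrite v'0 ui subrr normr0 exprS mul0r mulr0.
have tp : 0 < t by rewrite lt_neqAle eq_sym t00.
have [Q QL ->] := v'Q t t0h.
rewrite opprD addrA mulrDl; apply: le_trans (ler_normB _ _) _.
apply: lerD; first exact: yerr.
have tk : 0 < CE * t ^+ k.+2 by rewrite mulr_gt0 ?exprn_gt0.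
(* [eta] is [CE * t ^+ k.+2], the residual bound at the final time [t], which dominates it on all of
   [[0, t]]. *)
rewrite -mulrA exprSr (mulrA CE); apply: (HA _ _ _ _ _ _ _ tame) QL => //.
move=> nu s x nuL s0t xr; have s0h : 0 <= s <= h.
  by case/andP: s0t => -> st; exact: le_trans th.
apply: le_trans (Gs _ _ _ nuL s0h xr) _; rewrite ler_wpM2l// lerD2l.
apply: le_trans (Ebound s s0h) _; rewrite ler_pM2l//.
by rewrite lerXn2r ?nnegrE//; case/andP: s0t.
Qed.

Lemma tame_fields_lipschitz Lam (g : nat -> R -> vec -> vec) (c : vec) (r L : R) :
  0 < r -> 0 <= L ->
  (forall nu, (1 <= nu <= Lam)%N -> locally_lipschitz_at r L c (g nu)) ->
  exists2 M, 0 <= M & exists2 H0, 0 < H0 &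
    forall H, 0 < H <= H0 -> tame_fields Lam g c r H M L.
Proof.
move=> r0 L0 gL; pose S := \sum_(1 <= i < Lam.+1) `|g i 0 c|.
have S0 : 0 <= S by apply: sumr_ge0.
have Lr0 : 0 <= L * (r + r) by rewrite mulr_ge0// addr_ge0 ?ltW.
(* [S] dominates every [|g nu 0 c|], the time and space increments are at most [r] each, and 1 makes
   the bound strict. *)
pose M := L * (r + r) + S + 1.
have M0 : 0 <= M by rewrite !addr_ge0.
exists M => //.
have [|H0 H00 small] := @exists_small [:: r^-1; Lam%:R * M / r].
  by rewrite /= invr_ge0 (ltW r0) !mulr_ge0 ?invr_ge0 ?(ltW r0).
exists H0 => // H HH0; have /and3P[Hr HM _] := small H HH0.
rewrite ler_pdivrMr// mul1r in Hr; rewrite mulrA ler_pdivrMr// mul1r in HM.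
split => //; first by rewrite mulrA mulrC.
  move=> nu t x nuL /andP[t0 tH] xr; rewrite -[g _ _ _](subrK (g nu 0 c)).
  have tr : 0 <= t <= r by rewrite t0 (le_trans tH).
  have r00 : 0 <= (0 : R) <= r by rewrite lexx ltW.
  apply: le_lt_trans (ler_normD _ _) _; rewrite /M ltr_pwDr//; apply: lerD.
    apply: le_trans (gL _ nuL _ _ _ _ tr r00 xr _) _; first by rewrite subrr normr0 ltW.
    rewrite ler_wpM2l//; apply: lerD => //; rewrite subr0 ger0_norm//.
    by case/andP: tr.
  rewrite /S (big_cat_nat (n := nu))/=; [|by case/andP: nuL|by case/andP: nuL => _ /leqW].
  rewrite [X in _ + X]big_ltn; last by case/andP: nuL.
  by rewrite addrCA lerDl addr_ge0// sumr_ge0.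
move=> nu t x y nuL /andP[t0 tH] xr yr.
have tr : 0 <= t <= r by rewrite t0 (le_trans tH).
by apply: le_trans (gL _ nuL _ _ _ _ tr tr xr yr) _; rewrite subrr normr0 add0r.
Qed.

Lemma lie_trotter_second_order Lam (g : nat -> R -> vec -> vec) (c : vec) (r L H M : R) :
  (0 < Lam)%N -> 0 <= H -> H <= r -> 
  (forall nu, (1 <= nu <= Lam)%N -> locally_lipschitz_at r L c (g nu)) ->
  tame_fields Lam g c r H M L ->
  exists2 A : R, 0 <= A & forall tau y, 0 <= tau <= H ->
    lie_trotter Lam g c tau y ->
    `|y - c - tau *: total_field Lam g 0 c| <= A * tau ^+ 2.
Proof.
move=> Lam0 H0 Hr gL tame; apply: lie_trotter_consistent tame _ => //.
move=> nu t x nuL /andP[t0 tH] xr; have r0 : 0 <= r by exact: le_trans Hr.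
have := gL nu nuL t 0 x c; rewrite t0 (le_trans tH)// lexx r0 subrr normr0.
by rewrite subr0 ger0_norm//; exact.
Qed.

(** The exact solution is itself a splitting result, with the total field as the only sub-problem.
    Consistency applies to [u] and to [v] with the same first-order term, so they differ by
    O(t^2). *)
Lemma approximates_prediction Lam (f : nat -> R -> vec -> vec) (u0 : vec)
    (u : R -> vec) (r L T : R) :
  (0 < Lam)%N -> 0 < r -> 0 <= L -> 0 < T ->
  (forall nu, (1 <= nu <= Lam)%N -> locally_lipschitz_at r L u0 (f nu)) ->
  u 0 = u0 -> ode_solution T (total_field Lam f) u ->
  exists H M C : R, [/\ 0 < H <= T, 0 <= M, 0 <= C,
    forall t, 0 <= t <= H -> `|u t - u0| <= M * t
  & forall h v, 0 < h <= H -> v 0 = u0 ->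
    (forall tau, 0 < tau <= h -> lie_trotter Lam f u0 tau (v tau)) ->
    approximates u0 u 0 h C v].
Proof.
move=> Lam0 r0 L0 T0 fL ui usol; pose F (_ : nat) := total_field Lam f.
have FL nu : (1 <= nu <= 1)%N -> locally_lipschitz_at r (Lam%:R * L) u0 (F nu).
  by move=> _; exact: total_field_lipschitz.
have LF0 : 0 <= Lam%:R * L by exact: mulr_ge0.
have [Mf Mf0 [Hf Hf0 ftame]] := tame_fields_lipschitz r0 L0 fL.
have [MF MF0 [HF HF0 Ftame]] := tame_fields_lipschitz r0 LF0 FL.
have [|H' H'0 small] := @exists_small [:: Hf^-1; HF^-1; r^-1; T^-1; 2 * L].
  by rewrite /= !invr_ge0 (ltW Hf0) (ltW HF0) (ltW r0) (ltW T0) mulr_ge0.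
have H'I : 0 < H' <= H' by rewrite H'0 lexx.
have /and5P[HHf HHF Hr HT /andP[HL _]] := small H' H'I.
rewrite ler_pdivrMr// mul1r in HHf; rewrite ler_pdivrMr// mul1r in HHF.
rewrite ler_pdivrMr// mul1r in Hr; rewrite ler_pdivrMr// mul1r in HT.
have ft h : 0 < h <= H' -> tame_fields Lam f u0 r h Mf L.
  by move=> /andP[h0 hH]; apply: ftame; rewrite h0 (le_trans hH).
have Ft : tame_fields 1 F u0 r H' MF (Lam%:R * L) by apply: Ftame; rewrite H'0.
have [A A0 HA] := lie_trotter_second_order Lam0 (ltW H'0) Hr fL (ft _ H'I).
have [B B0 HB] := lie_trotter_second_order (ltn0Sn 0) (ltW H'0) Hr FL Ft.
have ult t : 0 <= t <= H' -> lie_trotter 1 F u0 t (u t).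
  move=> /andP[t0 tH]; exists (fun _ => u); split => //.
    by move=> nu /andP[n2 n1]; have := leq_trans n2 n1.
  move=> nu _ s; rewrite in_itv/= => /andP[s0 st].
  apply: (@is_deriv_within_sub _ _ `[0, T]%classic).
    by apply: subset_itvl; rewrite bnd_simp (le_trans tH).
  by apply: ode_solution_deriv usol _; rewrite s0 (le_trans st)// (le_trans tH).
exists H', MF, (A + B); split => //.
- by rewrite H'0.
- exact: addr_ge0.
- move=> t t0; have := lie_trotter_near (ltn0Sn 0) Ft t0 (ult t t0).
  by rewrite mul1r.
move=> h v hH v0 vlt; have /andP[h0 hH'] := hH.
have vlt' t : 0 <= t <= h -> lie_trotter Lam f u0 t (v t).
  move=> /andP[t0 th]; have [->|t00] := eqVneq t 0.
    by rewrite v0; exact: lie_trotter0.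
  by apply: vlt; rewrite lt_neqAle eq_sym t00 t0.
have hL : 2 * (L * h) <= 1.
  by rewrite mulrA mulrC (le_trans _ HL)// ler_wpM2r// mulr_ge0.
split => //.
  apply: (lipschitz_itv_splitting Lam0 (ft _ hH) (ltW h0) hL (lexx 0) (y := fun=> 0)).
    by move=> s t _ _; rewrite subrr normr0 mul0r.
  by move=> t t0h; exists (v t); [exact: vlt'|rewrite add0r].
move=> t t0h; have t0H : 0 <= t <= H' by case/andP: t0h => -> /le_trans; apply.
have hA := HA t (v t) t0H (vlt' t t0h).
have := HB t (u t) t0H (ult t t0H); rewrite {1}/total_field big_nat1 => hB.
rewrite (_ : u t - v t = (u t - u0 - t *: F 1%N 0 u0) -
   (v t - u0 - t *: total_field Lam f 0 u0)); last first.
  by apply/rowP => j; rewrite !mxE; ring.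
by apply: le_trans (ler_normB _ _) _; rewrite addrC mulrDl lerD.
Qed.

End idc_order.

Theorem theorem4p1 (R : realType) (n Lam cs : nat)
    (f : nat -> R -> 'rV[R]_n -> 'rV[R]_n) (T : R) (u : R -> 'rV[R]_n)
    (u0 : 'rV[R]_n) (U : R -> nat -> R -> 'rV[R]_n)
    (hLam : (2 <= Lam)%N) (hT : 0 < T)
    (u_init : u 0 = u0)
    (u_sol : ode_solution T (total_field Lam f) u)
    (u_diff : times_differentiable cs.+3 `[0, T] u)
    (f_diff : forall nu, (1 <= nu <= Lam)%N ->
       times_differentiable cs.+3
         [set p : R * 'rV[R]_n | 0 <= p.1] (fun p => f nu p.1 p.2))
    (U_idc : \forall h \near 0^'+, idc_approximations Lam cs f u0 h (U h)) :
  (fun h : R => `|u h - U h cs h|) =O_ (0^'+) (fun h : R => h ^+ (cs + 2)).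
Proof.
have Lam0 : (0 < Lam)%N by exact: ltnW.
have [r [L [r0 L0 fL]]] := locally_lipschitz_uniform
  (fun nu nuL => times_differentiable_lipschitz u0 (f_diff nu nuL)).
have [H [M [C [/andP[H0 HT] M0 C0 uM pred]]]] :=
  approximates_prediction Lam0 r0 L0 hT fL u_init u_sol.
have usolH : ode_solution H (total_field Lam f) u.
  move=> t; rewrite in_itv/= => /andP[t0 tH].
  apply: (@is_deriv_within_sub _ _ `[0, T]%classic).
    by apply: subset_itvl; rewrite bnd_simp.
  by apply: ode_solution_deriv u_sol _; rewrite t0 (le_trans tH).
(* Induction over the corrections with constants independent of [h]; the threshold for [h] shrinks
   at each of the finitely many corrections. *)
have main k : (k <= cs)%N -> exists2 C', 0 <= C' & exists2 h0, 0 < h0 &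
    forall h V, 0 < h <= h0 -> idc_approximations Lam cs f u0 h V ->
    approximates u0 u k h C' (V k).
  elim: k => [|k ih] kcs.
    exists C => //; exists H => // h V hH [V0 Vpred _].
    by apply: pred => //; exact: V0.
  have [C1 C10 [h1 h10 H1]] := ih (ltnW kcs).
  have [C2 C20 [h2 h20 H2]] :=
    approximates_correction Lam0 r0 L0 H0 M0 fL u_init usolH uM k C10.
  exists C2 => //; exists (Num.min h1 h2); first by rewrite lt_min h10.
  move=> h V; rewrite le_min => /andP[hp /andP[hh1 hh2]] idc.
  have [V0 _ Vcorr] := idc.
  apply: (H2 h (V k)) => //; first by rewrite hp.
  - by apply: H1 => //; rewrite hp.
  - exact: V0.
  - by move=> tau tauh; apply: (Vcorr k.+1) => //; rewrite in_itv.
have [C' C'0 [h0 h00 Hcs]] := main cs (leqnn cs).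
(* The big-O constant has to be positive, whereas [C'] may be 0. *)
apply/eqO_exP; exists (C' + 1); first by rewrite ltr_wpDl.
near=> h.
have hp : 0 < h by near: h; exact: nbhs_right_gt.
have hh0 : h <= h0 by near: h; exact: nbhs_right_le.
have [_ _ err] : approximates u0 u cs h C' (U h cs).
  by apply: Hcs; [rewrite hp|near: h].
rewrite normr_id; apply: le_trans (err h _) _; first by rewrite lexx ltW.
have hk : 0 <= h ^+ cs.+2 by rewrite exprn_ge0// ltW.
by rewrite addn2 ger0_norm// ler_wpM2r// lerDl.
Unshelve. all: by end_near. Qed.
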